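(* In the setting and under the regularity assumption of the context, the primal DRO problem $\inf_{x\in\mathcal X}\sup_{\mathbb Q\in\mathcal P}\mathbb E_{z\sim\mathbb Q}[\ell(x,z)]$ and the dual DRO problem $\sup_{\mathbb Q\in\mathcal P}\inf_{x\in\mathcal X}\mathbb E_{z\sim\mathbb Q}[\ell(x,z)]$ have finite optimal values and admit a saddle point (a pair $(x^\star,\mathbb Q^\star)\in\mathcal X\times\mathcal P$ with $\mathbb E_{\mathbb Q}[\ell(x^\star,z)]\le\mathbb E_{\mathbb Q^\star}[\ell(x^\star,z)]\le\mathbb E_{\mathbb Q^\star}[\ell(x,z)]$ for all $x\in\mathcal X$, $\mathbb Q\in\mathcal P$). In particular, $$\min_{x\in\mathcal X}\max_{\mathbb Q\in\mathcal P}\mathbb E_{z\sim\mathbb Q}[\ell(x,z)]=\max_{\mathbb Q\in\mathcal P}\min_{x\in\mathcal X}\mathbb E_{z\sim\mathbb Q}[\ell(x,z)].$$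
   Context: Notation: $[n]=\{1,\dots,n\}$; $\mathcal P(\mathcal Z)$ is the set of Borel probability measures on $\mathcal Z$. Setting. $\mathcal X\subseteq\mathbb R^n$, $\mathcal Z\subseteq\mathbb R^m$. A transportation cost $c:\mathcal Z\times\mathcal Z\to\mathbb R_+$ is lower semicontinuous, satisfies $c(z,z)=0$ for all $z$, and $c(\cdot,\hat z)$ is convex for every fixed $\hat z\in\mathcal Z$. The optimal transport discrepancy is $\mathrm{OT}_c(\mathbb P,\mathbb Q)=\min_{\gamma}\mathbb E_{(z,\hat z)\sim\gamma}[c(z,\hat z)]$ over couplings $\gamma$ of $\mathbb P$ and $\mathbb Q$. Given $\hat z_1,\dots,\hat z_N\in\mathcal Z$, let $\hat{\mathbb P}=\frac1N\sum_{i=1}^N\delta_{\hat z_i}$; given $\rho>0$, let $\mathcal P=\{\mathbb P\in\mathcal P(\mathcal Z):\mathrm{OT}_c(\mathbb P,\hat{\mathbb P})\le\rho\}$. Regularity assumption. (i) $\mathcal X$ is nonempty and convex; there exist $\mathbb Q_0\in\mathcal P$ and $x_0\in\mathcal X$ such that $x\mapsto\mathbb E_{z\sim\mathbb Q_0}[\ell(x,z)]$ is inf-compact on $\mathcal X$ (all sublevel sets $\{x\in\mathcal X:\mathbb E_{\mathbb Q_0}[\ell(x,z)]\le a\}$, $a\in\mathbb R$, are compact) and $\mathbb E_{z\sim\mathbb Q_0}[\ell(x_0,z)]>-\infty$; $\mathcal Z$ is nonempty, closed and convex. (ii) $\ell(x,z)=\max_{k\in[K]}\ell_k(x,z)$ with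 $K\ge2$, where each $\ell_k:\mathbb R^n\times\mathbb R^m\to\mathbb R$ is real-valued, convex in its first and concave in its second argument. (iii) There exist a norm $\|\cdot\|$ on $\mathbb R^m$ and $p\ge1$ with $c(z,\hat z)\ge\|z-\hat z\|^p$ for all $z,\hat z\in\mathcal Z$; moreover, if $p=1$, then for every $x\in\mathcal X$ there exist $g>0$, $\hat z_0\in\mathcal Z$ and $r\in[0,1)$ such that $\ell(x,z)\le g[1+\|z-\hat z_0\|^r]$ for all $z\in\mathcal Z$. *)

(* Defs.v *)
From HB Require Import structures.
From mathcomp Require Import all_boot all_order all_algebra.
From mathcomp Require Import all_classical all_reals all_analysis.
Set Implicit Arguments.
Unset Strict Implicit.
Unset Printing Implicit Defensive.
Import Order.TTheory GRing.Theory Num.Theory.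
Import numFieldNormedType.Exports.
Local Open Scope classical_set_scope.
Local Open Scope ring_scope.

Definition is_maximum d (T : porderType d) (S : set T) (v : T) : Prop :=
  S v /\ ubound S v.

Definition is_minimum d (T : porderType d) (S : set T) (v : T) : Prop :=
  S v /\ lbound S v.

Record is_norm (R : realType) (m : nat) (nrm : 'rV[R]_m -> R) : Prop := IsNorm {
  norm_eq0_imp : forall z, nrm z = 0 -> z = 0 ;
  norm_homogeneous : forall a z, nrm (a *: z) = `|a| * nrm z ;
  norm_triangle : forall z w, nrm (z + w) <= nrm z + nrm w }.

(* R^m with the sigma-algebra generated by its open sets. *)
Definition borel_rV (R : realType) (m : nat) :=
  g_sigma_algebraType (@open 'rV[R]_m).

(* The cost is only relevant on Z x Z; lower semicontinuity is with respect to
   the subspace topology of Z x Z. *)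
Record transportation_cost (R : realType) (m : nat) (Z : set 'rV[R]_m)
    (c : 'rV[R]_m -> 'rV[R]_m -> R) : Prop := TransportationCost {
  cost_ge0 : forall z zh, Z z -> Z zh -> 0 <= c z zh ;
  cost_lsc : lower_semicontinuous
    (fun u : subspace (Z `*` Z) => (c u.1 u.2)%:E) ;
  cost_diag : forall z, Z z -> c z z = 0 ;
  cost_convex : forall zh, Z zh -> convex_function Z (c ^~ zh) }.

Section optimal_transport.
Context (R : realType) (m : nat).
Local Open Scope ereal_scope.
Local Notation T := (borel_rV R m).

Definition coupling (P Q : {measure set T -> \bar R})
    (gamma : probability (T * T)%type R) : Prop :=
  forall A : set T, measurable A ->
    pushforward gamma fst A = P A /\ pushforward gamma snd A = Q A.

(* For P and Q concentrated on Z, every coupling is concentrated on Z x Z, so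
   that the integral over Z x Z is the expectation of the cost. *)
Definition ot (Z : set 'rV[R]_m) (c : 'rV[R]_m -> 'rV[R]_m -> R)
    (P Q : {measure set T -> \bar R}) : \bar R :=
  ereal_inf [set \int[gamma]_(u in (Z `*` Z : set (T * T))) (c u.1 u.2)%:E |
             gamma in [set gamma | coupling P Q gamma]].

Definition empirical (N : nat) (zhat : 'I_N -> 'rV[R]_m) (A : set T) : \bar R :=
  (N%:R^-1)%:E * \sum_(i < N) dirac (zhat i : T) A.

Section empirical_measure.
Variables (N : nat) (zhat : 'I_N -> 'rV[R]_m).

Let empirical0 : empirical zhat set0 = 0.
Proof. by rewrite /empirical big1 ?mule0// => i _; rewrite measure0. Qed.

Let empirical_ge0 A : 0 <= empirical zhat A.
Proof. by rewrite /empirical mule_ge0 ?sume_ge0// lee_fin invr_ge0. Qed.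

Let empirical_sigma_additive : semi_sigma_additive (empirical zhat).
Proof.
pose f k : {measure set T -> \bar R} :=
  if insub k is Some i then dirac (zhat i : T) else mzero.
have r0 : (0 <= N%:R^-1 :> R)%R by rewrite invr_ge0.
rewrite (_ : empirical zhat = mscale (NngNum r0) (msum f N)).
  exact: measure_semi_sigma_additive.
apply/funext => A; rewrite /mscale/= /msum /empirical; congr (_ * _).
by apply: eq_bigr => i _; rewrite /f valK.
Qed.

HB.instance Definition _ := isMeasure.Build _ _ _ (empirical zhat)
  empirical0 empirical_ge0 empirical_sigma_additive.

End empirical_measure.

(* The Borel probability measures on the closed set Z are represented by the
   Borel probability measures on R^m that give mass 1 to Z. *)
Definition ambiguity_set (Z : set 'rV[R]_m) (c : 'rV[R]_m -> 'rV[R]_m -> R)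
    (N : nat) (zhat : 'I_N -> 'rV[R]_m) (rho : R) : set (probability T R) :=
  [set P : probability T R | P (Z : set T) = 1 /\ ot Z c P (empirical zhat) <= rho%:E].

End optimal_transport.

Section dro.
Context (R : realType) (n m : nat).
Local Open Scope ereal_scope.
Local Notation T := (borel_rV R m).
Variables (X : set 'rV[R]_n) (P : set (probability T R)).
Variable ell : 'rV[R]_n -> 'rV[R]_m -> R.

(* An integral whose positive and negative parts are both infinite is -oo by
   convention; a growth condition on the loss that makes its positive part
   integrable rules this case out. *)
Definition risk (Q : probability T R) (x : 'rV[R]_n) : \bar R := 'E_Q[ell x].

Definition inf_compact (f : 'rV[R]_n -> \bar R) : Prop :=
  forall a : R, compact [set x | X x /\ f x <= a%:E].

Definition primal_value : \bar R :=
  ereal_inf [set ereal_sup [set risk Q x | Q in P] | x in X].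

Definition dual_value : \bar R :=
  ereal_sup [set ereal_inf [set risk Q x | x in X] | Q in P].

Definition saddle_point (xs : 'rV[R]_n) (Qs : probability T R) : Prop :=
  [/\ X xs, P Qs &
      forall x Q, X x -> P Q ->
        risk Q xs <= risk Qs xs /\ risk Qs xs <= risk Qs x].

End dro.

(* Main.v *)
(* Fix a decision [x] and a distribution [Q] in the ambiguity set.  Splitting a
   (nearly optimal) coupling of [Q] with the empirical measure according to the
   sample [zhat i] and to the piece [k] of the loss active at [x], and replacing
   each of the [N * K] cells by its barycenter, Jensen's inequality increases the
   expected loss and decreases the transport cost.  Hence only finitely
   supported distributions with [N * K] atoms matter, and with the payoff
   [\sum_i \sum_k p i k * ellk k x (z i k)] they form a game that is convex in
   [x] and, by merging atoms, concave in the adversary.  The adversary's set is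
   sequentially compact: an atom of vanishing mass may escape to infinity, but
   the growth condition makes its contribution to the payoff vanish.  A minimax
   theorem on a compact sublevel set of the risk of [Q0] gives a saddle point of
   this game, which extends to [X] by convexity and is a saddle point of the
   original problem. *)

Require Import Defs.
From HB Require Import structures.
From mathcomp Require Import all_boot all_order all_algebra finmap.
From mathcomp Require Import all_classical all_reals all_analysis measurable_realfun.
From mathcomp Require Import ring lra.
Set Implicit Arguments.
Unset Strict Implicit.
Unset Printing Implicit Defensive.
Import Order.TTheory GRing.Theory Num.Theory.
Import numFieldNormedType.Exports.
Local Open Scope classical_set_scope.
Local Open Scope ring_scope.

(** * Convexity and continuity *)

Section convexity.
Context {R : realType}.

Lemma convex_setP (V : lmodType R) (A : set V) :
  convex_set A <->
  forall x y (a b : R), A x -> A y -> 0 <= a -> 0 <= b -> a + b = 1 ->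
    A (a *: x + b *: y).
Proof.
split=> [cA x y a b Ax Ay a0 b0 ab|cA x y l /set_mem Ax /set_mem Ay].
  have a1 : a <= 1 by rewrite -ab lerDl.
  have aI : Itv.spec (Itv.num_sem (R := R)) (Itv.Real `[0%Z, 1%Z]) a.
    by rewrite /= /Itv.num_sem/= num_real/= in_itv/= a0 a1.
  have := cA x y (Itv.mk aI) (mem_set Ax) (mem_set Ay).
  rewrite inE /conv/= /unstable.onem.
  by have -> : b = 1 - a by rewrite -ab addrAC subrr add0r.
by apply/mem_set; apply: cA => //; rewrite ?subr_ge0 ?subrKC.
Qed.

Lemma convex_functionP (V : lmodType R) (A : set V) (f : V -> R) :
  convex_function A f <->
  forall x y (a b : R), A x -> A y -> 0 <= a -> 0 <= b -> a + b = 1 ->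
    f (a *: x + b *: y) <= a * f x + b * f y.
Proof.
split=> [cA x y a b Ax Ay a0 b0 ab|cA l x y /set_mem Ax /set_mem Ay].
  have a1 : a <= 1 by rewrite -ab lerDl.
  have aI : Itv.spec (Itv.num_sem (R := R)) (Itv.Real `[0%Z, 1%Z]) a.
    by rewrite /= /Itv.num_sem/= num_real/= in_itv/= a0 a1.
  have := cA (Itv.mk aI) x y (mem_set Ax) (mem_set Ay).
  rewrite /conv/= /unstable.onem.
  by have -> : b = 1 - a by rewrite -ab addrAC subrr add0r.
by apply: cA => //; rewrite ?subr_ge0 ?subrKC.
Qed.

End convexity.

Section continuity.
Context {R : realType}.

Lemma cvg_sumr (T I : Type) (F : set_system T) (r : seq I) (P : pred I)
    (f : I -> T -> R) (l : I -> R) :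
  Filter F -> (forall i, P i -> f i x @[x --> F] --> l i) ->
  \sum_(i <- r | P i) f i x @[x --> F] --> \sum_(i <- r | P i) l i.
Proof.
move=> FF fl; apply: cvg_big => // -[a b].
exact: (@add_continuous R^o (a, b)).
Qed.

Lemma continuous_sumr (T : topologicalType) (I : Type) (r : seq I) (P : pred I)
    (f : I -> T -> R) :
  (forall i, P i -> continuous (f i)) ->
  continuous (fun x => \sum_(i <- r | P i) f i x).
Proof. by move=> cf x; apply: cvg_sumr => i /cf; exact. Qed.

Lemma closed_sublevel (T : topologicalType) (f : T -> R) a :
  continuous f -> closed [set x | f x <= a].
Proof. by move=> cf; apply: preimage_closed (@closed_le R a) => x _; exact: cf. Qed.

Lemma coord_le_norm (d : nat) (u : 'rV[R]_d) j : `|u ord0 j| <= `|u|.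
Proof.
rewrite [leRHS]/Num.norm/= mx_normrE.
exact: (le_bigmax _ (fun i : 'I_1 * 'I_d => `|u i.1 i.2|) (ord0, j)).
Qed.

Lemma rV_norm_le (d : nat) (u : 'rV[R]_d) a :
  0 <= a -> (forall j, `|u ord0 j| <= a) -> `|u| <= a.
Proof.
move=> a0 ua; rewrite [leLHS]/Num.norm/= mx_normrE.
by apply: bigmax_le => // -[i j] _ /=; rewrite (ord1 i).
Qed.

Lemma continuous_lsubmx (d k : nat) :
  continuous (lsubmx : 'rV[R]_(d + k) -> 'rV[R]_d).
Proof.
move=> u; apply/(@cvgrPdist_le _ _ _ (nbhs u) _ lsubmx (lsubmx u)) => e e0.
near=> v.
apply: (@le_trans _ _ `|u - v|).
  by apply: rV_norm_le => // j; have := coord_le_norm (u - v) (lshift k j);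
     rewrite !mxE.
by near: v; apply: (@cvgr_dist_le _ _ _ (nbhs u) _ id u) => //; exact: cvg_id.
Unshelve. all: by end_near. Qed.

End continuity.

Section convex_continuity.
Context {R : realType} (d : nat) (f : 'rV[R]_d -> R).
Hypothesis cf : convex_function [set: 'rV[R]_d] f.

Lemma convex_bounded_cube (z0 : 'rV[R]_d) :
  exists M, forall h, `|h| <= 1 -> f (z0 + h) <= M.
Proof.
have /convex_functionP cvf := cf.
suff H k : forall z0 : 'rV[R]_d, exists M, forall h : 'rV[R]_d,
    (forall j, `|h ord0 j| <= 1) ->
    (forall j : 'I_d, (k <= j)%N -> h ord0 j = 0) -> f (z0 + h) <= M.
  have [M HM] := H d z0; exists M => h h1; apply: HM.
    by move=> j; apply: le_trans h1; exact: coord_le_norm.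
  by move=> j; rewrite leqNgt ltn_ord.
elim: k => [|k IH] {}z0.
  exists (f z0) => h _ h0.
  suff -> : h = 0 by rewrite addr0.
  by apply/rowP => j; rewrite mxE h0.
have [dk|kd] := leqP d k.
  have [M HM] := IH z0; exists M => h h1 h0; apply: HM => // j kj.
  by have := leq_trans dk kj; rewrite leqNgt ltn_ord.
pose e : 'rV[R]_d := delta_mx ord0 (Ordinal kd).
have [M1 H1] := IH (z0 + e); have [M2 H2] := IH (z0 - e).
exists (Num.max M1 M2) => h h1 h0.
pose a := h ord0 (Ordinal kd).
have /andP[a1 a2] : -1 <= a <= 1 by rewrite -ler_norml; exact: h1.
pose h' := h - a *: e.
have h'E j : h' ord0 j = if j == Ordinal kd then 0 else h ord0 j.
  rewrite !mxE eqxx/=; case: eqVneq => [->|_]; first by rewrite mulr1 subrr.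
  by rewrite mulr0 subr0.
have h'1 j : `|h' ord0 j| <= 1.
  by rewrite h'E; case: ifP => // _; rewrite normr0.
have h'0 (j : 'I_d) : (k <= j)%N -> h' ord0 j = 0.
  move=> kj; rewrite h'E; case: eqVneq => // jk.
  by apply: h0; rewrite ltn_neqAle kj andbT; apply: contra jk => /eqP kj';
    apply/eqP/val_inj.
have -> : z0 + h = ((1 + a) / 2) *: (z0 + e + h') + ((1 - a) / 2) *: (z0 - e + h').
  by apply/rowP => j; rewrite !mxE; field.
have a0 : 0 <= (1 + a) / 2 by rewrite divr_ge0// -lerBlDl sub0r.
have b0 : 0 <= (1 - a) / 2 by rewrite divr_ge0// subr_ge0.
have ab : (1 + a) / 2 + (1 - a) / 2 = 1 by field.
apply: le_trans (cvf _ _ _ _ I I a0 b0 ab) _.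
have := H1 _ h'1 h'0; have := H2 _ h'1 h'0.
have m1 : M1 <= Num.max M1 M2 by rewrite le_max lexx.
have m2 : M2 <= Num.max M1 M2 by rewrite le_max lexx orbT.
move: (Num.max M1 M2) m1 m2 => M m1 m2 f2 f1.
have -> : M = (1 + a) / 2 * M + (1 - a) / 2 * M by field.
by rewrite lerD// ler_wpM2l// ?(le_trans f1)// ?(le_trans f2).
Qed.

(* Convexity along the line through [z0] and [z0 + h], compared with the points
   where it leaves the unit ball around [z0] on either side. *)
Let convex_dist (z0 h : 'rV[R]_d) (M : R) :
  (forall h, `|h| <= 1 -> f (z0 + h) <= M) ->
  f z0 - f (z0 + h) <= `|h| * (M - f z0) /\
  (`|h| <= 1 -> f (z0 + h) - f z0 <= `|h| * (M - f z0)).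
Proof.
move=> HM; have /convex_functionP cvf := cf.
have [->|hn0] := eqVneq h 0; first by rewrite normr0 addr0 subrr mul0r.
have t0 : 0 < `|h| by rewrite normr_gt0.
set t := `|h| in t0 *.
pose u := t^-1 *: h.
have tn0 : t != 0 by rewrite gt_eqF.
have u1 : `|u| <= 1.
  by rewrite normrZ gtr0_norm ?invr_gt0// -/t mulVf.
have hE : h = t *: u by rewrite scalerA divff// scale1r.
clearbody u t.
split.
  have t10 : 1 + t != 0 by rewrite gt_eqF// addr_gt0.
  have /(_ (z0 + h) (z0 - u) (1 / (1 + t)) (t / (1 + t)) I I) := cvf.
  have -> : (1 / (1 + t)) *: (z0 + h) + (t / (1 + t)) *: (z0 - u) = z0.
    by apply/rowP => j; rewrite hE !mxE; field.
  have t0' := ltW t0.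
  rewrite -mulrDl divff// !divr_ge0 ?addr_ge0// => /(_ isT isT erefl) H.
  have : f (z0 - u) <= M by apply: HM; rewrite normrN.
  move: H.
  have -> : 1 / (1 + t) * f (z0 + h) + t / (1 + t) * f (z0 - u) =
    (f (z0 + h) + t * f (z0 - u)) / (1 + t) by field.
  rewrite ler_pdivlMr ?ltr_pwDl//.
  by nra.
move=> t1.
have /(_ z0 (z0 + u) (1 - t) t I I) := cvf.
have -> : (1 - t) *: z0 + t *: (z0 + u) = z0 + h.
  by apply/rowP => j; rewrite hE !mxE; ring.
rewrite subr_ge0 t1 (ltW t0) subrK => /(_ isT isT erefl) H.
have := HM u u1; nra.
Qed.

Lemma convex_continuous : continuous f.
Proof.
move=> z0; have [M HM] := convex_bounded_cube z0.
have M0 : 0 <= M - f z0.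
  by rewrite subr_ge0; have := HM 0; rewrite addr0 normr0; apply.
apply/(@cvgrPdist_le _ R^o _ (nbhs z0) _ f (f z0)) => e e0.
pose C := M - f z0 + 1; have C0 : 0 < C by rewrite ltr_wpDl.
near=> z.
have zz : `|z - z0| <= Num.min 1 (e / C).
  rewrite distrC; near: z; apply: cvgr_dist_le; first exact: cvg_id.
  by rewrite lt_min ltr01 divr_gt0.
have := convex_dist (z - z0) HM; rewrite subrKC => -[A B].
move: zz; rewrite le_min => /andP[z1 ze].
have H : `|z - z0| * (M - f z0) <= e.
  apply: le_trans (_ : `|z - z0| * C <= _); last by rewrite -ler_pdivlMr.
  by apply: ler_wpM2l => //; rewrite lerDl.
rewrite ler_norml; apply/andP; split; last exact: le_trans H.
by rewrite lerNl opprB; apply: le_trans H; exact: B.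
Unshelve. all: by end_near. Qed.

Lemma convex_linear_lower_bound :
  exists2 A, 0 <= A & forall z, - f z <= A * (1 + `|z|).
Proof.
have [M HM] := convex_bounded_cube 0.
exists (`|M| + `|f 0|); first by rewrite addr_ge0.
move=> z; have [+ _] := convex_dist z HM; rewrite add0r.
have := normr_ge0 z; have := ler_norm M; have := ler_norm (f 0).
have := ler_norm (- f 0); rewrite normrN.
have := ler_norm (- M); rewrite normrN.
nra.
Qed.

End convex_continuity.

Lemma concave_continuous (R : realType) (d : nat) (f : 'rV[R]_d -> R) :
  convex_function [set: 'rV[R]_d] (fun z => - f z) -> continuous f.
Proof.
move=> cf z; rewrite (_ : f = fun z => - (- f z)); last first.
  by apply/funext => z'; rewrite opprK.
exact: (@cvgN _ R^o _ (nbhs z) _ _ _ (convex_continuous cf (x := z))).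
Qed.

(** * Strict separation and minimax *)

Section separation.
Context {R : realType} {d : nat}.
Implicit Types u v w : 'rV[R]_d.

Definition dotv u v : R := \sum_(j < d) u ord0 j * v ord0 j.

Lemma dotvC u v : dotv u v = dotv v u.
Proof. by apply: eq_bigr => j _; rewrite mulrC. Qed.

Lemma dotvDr u v w : dotv u (v + w) = dotv u v + dotv u w.
Proof. by rewrite -big_split; apply: eq_bigr => j _ /=; rewrite mxE mulrDr. Qed.

Lemma dotvZr a u v : dotv u (a *: v) = a * dotv u v.
Proof. by rewrite big_distrr; apply: eq_bigr => j _ /=; rewrite mxE; ring. Qed.

Lemma dotvBr u v w : dotv u (v - w) = dotv u v - dotv u w.
Proof. by rewrite dotvDr -scaleN1r dotvZr mulN1r. Qed.

Lemma sqr_coord_le_dotv u j : u ord0 j ^+ 2 <= dotv u u.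
Proof.
rewrite /dotv (bigD1 j)//= -expr2 lerDl sumr_ge0// => k _.
by rewrite -expr2 sqr_ge0.
Qed.

Lemma dotv_ge0 u : 0 <= dotv u u.
Proof. by apply: sumr_ge0 => j _; rewrite -expr2 sqr_ge0. Qed.

Lemma dotv_gt0 u : u != 0 -> 0 < dotv u u.
Proof.
move=> /rV0Pn[j uj]; apply: lt_le_trans (sqr_coord_le_dotv u j).
by rewrite exprn_even_gt0.
Qed.

Lemma continuous_dotv_sub w : continuous (fun u => dotv (u - w) (u - w)).
Proof.
have -> : (fun u => dotv (u - w) (u - w)) =
    (fun u => \sum_(j < d) (u ord0 j - w ord0 j) * (u ord0 j - w ord0 j)).
  by apply/funext => v; apply: eq_bigr => j _; rewrite !mxE.
apply: continuous_sumr => j _ u.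
have h : {for u, continuous (fun v : 'rV[R]_d => v ord0 j - w ord0 j)}.
  by apply: continuousB; [exact: coord_continuous|exact: cst_continuous].
exact: (continuousM h h).
Qed.

Lemma strict_separation (S : set 'rV[R]_d) b :
  closed S -> convex_set S -> ~ S b ->
  exists w (e : R), 0 < e /\ forall s, S s -> dotv w b + e <= dotv w s.
Proof.
move=> clS /convex_setP cvS Sb.
have [->|/set0P[s0 Ss0]] := eqVneq S set0; first by exists 0, 1; split.
pose f u := dotv (u - b) (u - b).
have cf : continuous f by exact: continuous_dotv_sub.
pose S0 := S `&` [set u | f u <= f s0].
have clS0 : closed S0.
  by apply: closedI => //; exact: closed_sublevel.
have bS0 : bounded_set S0.
  exists (`|b| + Num.sqrt (f s0)); split; first exact: num_real.
  move=> M hM u [_ us0]; apply: le_trans (ltW hM).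
  rewrite -[u](subrK b) addrC; apply: le_trans (ler_normD _ _) _.
  rewrite lerD2l; apply: rV_norm_le => [|j]; first exact: sqrtr_ge0.
  rewrite -sqrtr_sqr ler_sqrt ?dotv_ge0//.
  exact: le_trans (sqr_coord_le_dotv _ j) us0.
have [] := @EVT_min_rV R d f S0 _ (bounded_closed_compact bS0 clS0) _.
- by exists s0; split => //=.
- by apply: continuous_subspaceT => ?; exact: cf.
move=> s /set_mem[Ss /= fs] smin.
have {}smin t : S t -> f s <= f t.
  move=> St; have [ts0|/ltW ts0] := leP (f t) (f s0).
    by apply: smin; apply/mem_set.
  exact: le_trans ts0.
exists (s - b), (dotv (s - b) (s - b)); split.
  by rewrite dotv_gt0// subr_eq0; apply: contra_not_neq Sb => <-.
move=> t St; rewrite dotvBr addrCA subrr addr0 -subr_ge0 -dotvBr.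
rewrite leNgt; apply/negP => h0.
set h := dotv _ _ in h0; pose q := dotv (t - s) (t - s).
have q0 : 0 <= q by exact: dotv_ge0.
pose a := - h / (q - h).
have qh : 0 < q - h by rewrite ltr_wpDl// oppr_gt0.
have a0 : 0 < a by rewrite divr_gt0// oppr_gt0.
have a1 : a <= 1 by rewrite ler_pdivrMr// mul1r lerDr.
have /smin : S ((1 - a) *: s + a *: t).
  by apply: cvS => //; [rewrite subr_ge0|exact: ltW|rewrite subrK].
have -> : f ((1 - a) *: s + a *: t) = f s + a * (2 * h + a * q).
  rewrite /f /h /q.
  have -> : (1 - a) *: s + a *: t - b = (s - b) + a *: (t - s).
    by apply/rowP => j; rewrite !mxE; ring.
  move: (s - b) (t - s) => u v.
  rewrite dotvDr dotvZr !(dotvC (u + a *: v)) !dotvDr !dotvZr (dotvC v u).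
  by ring.
rewrite lerDl pmulr_rge0// leNgt => /negP; apply.
have -> : a * q = - h * (q / (q - h)) by rewrite /a; field; rewrite gt_eqF.
have : q / (q - h) <= 1 by rewrite ler_pdivrMr// mul1r lerDl oppr_ge0 ltW.
nra.
Qed.

End separation.

Section minimax.
Context {R : realType}.

Definition mixable (T : Type) (A : set T) (G : set (T -> R)) :=
  forall g1 g2 (a b : R), G g1 -> G g2 -> 0 <= a -> 0 <= b -> a + b = 1 ->
    exists2 g, G g & forall x, A x -> a * g1 x + b * g2 x <= g x.

Lemma mixable_sum (T : Type) (A : set T) (G : set (T -> R)) (I : eqType)
    (r : seq I) (g : I -> T -> R) (w : I -> R) :
  mixable A G -> (forall i, G (g i)) -> (forall i, 0 <= w i) ->
  0 < \sum_(i <- r) w i ->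
  exists2 h, G h & forall x, A x ->
    \sum_(i <- r) w i * g i x <= (\sum_(i <- r) w i) * h x.
Proof.
move=> mG Gg w0; elim: r => [|i r IH]; first by rewrite big_nil ltxx.
rewrite big_cons => W0.
have [r0|rn0] := eqVneq (\sum_(i <- r) w i) 0.
  exists (g i) => // x _; rewrite big_cons r0 addr0.
  rewrite (_ : \sum_(j <- r) _ = 0) ?addr0//.
  apply: big1_seq => j /andP[_ jr].
  move: r0 => /eqP; rewrite psumr_eq0// => /allP/(_ _ jr)/= /eqP ->.
  by rewrite mul0r.
have r0 : 0 < \sum_(i <- r) w i by rewrite lt_def rn0 sumr_ge0.
have [h Gh hle] := IH r0; set W := \sum_(i <- r) w i in W0 rn0 r0 hle *.
have Wn0 : w i + W != 0 by rewrite gt_eqF.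
have [|||k Gk kle] := mG (g i) h (w i / (w i + W)) (W / (w i + W)) (Gg i) Gh.
- by rewrite divr_ge0// ltW.
- by rewrite divr_ge0// ltW.
- by rewrite -mulrDl divff.
exists k => // x Ax; rewrite big_cons.
have := kle x Ax; have := hle x Ax.
have -> : w i / (w i + W) * g i x + W / (w i + W) * h x =
  (w i * g i x + W * h x) / (w i + W) by field.
by rewrite ler_pdivrMr// mulrC; lra.
Qed.

Lemma closed_upper_image (n k : nat) (A : set 'rV[R]_n)
    (g : 'I_k -> 'rV[R]_n -> R) :
  compact A -> (forall j, continuous (g j)) ->
  closed [set y : 'rV[R]_k | exists2 x, A x & forall j, g j x <= y ord0 j].
Proof.
move=> /compact_near_coveringP cA cg y cly; apply: contrapT => nSy.
have H : \forall y' \near nbhs y,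
    A `<=` (fun x => exists j, (y' : 'rV[R]_k) ord0 j < g j x).
  apply: cA => x Ax.
  have [j yj] : exists j, y ord0 j < g j x.
    apply: contrapT => /forallNP nj; apply: nSy; exists x => // j.
    by rewrite leNgt; apply/negP.
  pose a := (y ord0 j + g j x) / 2.
  have ya : y ord0 j < a by rewrite /a; lra.
  have ag : a < g j x by rewrite /a; lra.
  exists ([set x' | a < g j x'], [set y' : 'rV[R]_k | y' ord0 j < a]); last first.
    by case=> x' y' /= [ax ya']; exists j; exact: lt_trans ax.
  split=> /=.
    by apply: (@cvgr_gt _ _ (nbhs x) _ (g j) (g j x)) => //; exact: cg.
  apply: (@cvgr_lt _ _ (nbhs y) _ (fun u : 'rV[R]_k => u ord0 j)
    (y ord0 j)) => //.
  exact: coord_continuous.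
have [y' [[x Ax gx] /(_ x Ax)[j]]] := cly _ H.
by rewrite ltNge gx.
Qed.

Lemma minimax_compact (n : nat) (A : set 'rV[R]_n) (G : set ('rV[R]_n -> R))
    (v : R) :
  A !=set0 -> compact A -> convex_set A ->
  (forall g, G g -> convex_function [set: 'rV[R]_n] g) -> mixable A G ->
  (forall g, G g -> exists2 x, A x & g x <= v) ->
  exists2 x, A x & forall g, G g -> g x <= v.
Proof.
move=> [x0 Ax0] cA /convex_setP cvA cvG mG Gv.
have cG g : G g -> continuous g by move=> /cvG; exact: convex_continuous.
apply: contrapT => noX.
have := cA; rewrite compact_cover.
move=> /(_ _ G (fun g => [set x | v < g x])).
case=> [g /cG cg|x Ax|D DG AD].
- rewrite (_ : [set x | v < g x] = g @^-1` [set y | v < y])//.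
  by apply: open_comp => [x _|]; [exact: cg|exact: open_gt].
- apply: contrapT => nx; apply: noX; exists x => // g Gg.
  by rewrite leNgt; apply/negP => vg; apply: nx; exists g.
pose k := size (enum_fset D).
pose gs (j : 'I_k) := tnth (in_tuple (enum_fset D)) j.
have Ggs j : G (gs j) by apply/set_mem/DG; exact: mem_tnth.
pose S := [set y : 'rV[R]_k | exists2 x, A x & forall j, gs j x <= y ord0 j].
have clS : closed S by apply: closed_upper_image => // j; exact: cG.
have cvS : convex_set S.
  apply/convex_setP => y z a b [x Ax xy] [x' Ax' xz] a0 b0 ab.
  exists (a *: x + b *: x'); first exact: cvA.
  move=> j; have /cvG/convex_functionP := Ggs j.
  move=> /(_ x x' a b I I a0 b0 ab) /le_trans; apply.
  by rewrite !mxE lerD// ler_wpM2l.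
have [|w [e [e0 we]]] := strict_separation (b := const_mx v) clS cvS.
  move=> [x Ax xv]; have [g gD vg] := AD x Ax.
  have /tnthP[j gj] : g \in in_tuple (enum_fset D) by exact: gD.
  by have := xv j; rewrite mxE /gs -gj leNgt vg.
have dotc : dotv w (const_mx v) = (\sum_j w ord0 j) * v.
  by rewrite big_distrl; apply: eq_bigr => j _; rewrite mxE.
have wg x : A x -> (\sum_j w ord0 j) * v + e <= \sum_j w ord0 j * gs j x.
  move=> Ax; have := we (\row_j gs j x); rewrite dotc.
  have -> : dotv w (\row_j gs j x) = \sum_j w ord0 j * gs j x.
    by apply: eq_bigr => j _; rewrite mxE.
  by apply; exists x => // j; rewrite mxE.
have w0 j : 0 <= w ord0 j.
  rewrite leNgt; apply/negP => wj.
  pose B := \sum_j w ord0 j * gs j x0 - (\sum_j w ord0 j) * v.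
  have B0 : 0 <= B by have := wg _ Ax0; rewrite /B; lra.
  have /we : S (\row_j gs j x0 + (B / - w ord0 j) *: delta_mx ord0 j).
    exists x0 => // i; rewrite !mxE lerDl mulr_ge0// divr_ge0//.
    by rewrite oppr_ge0 ltW.
  rewrite dotvDr dotvZr dotc.
  have -> : dotv w (\row_j gs j x0) = \sum_j w ord0 j * gs j x0.
    by apply: eq_bigr => i _; rewrite mxE.
  have -> : dotv w (delta_mx ord0 j) = w ord0 j.
    rewrite /dotv (bigD1 j)//= mxE !eqxx mulr1 big1 ?addr0// => i ij.
    by rewrite mxE eqxx (negbTE ij) mulr0.
  have -> : B / - w ord0 j * w ord0 j = - B by field; rewrite lt_eqF.
  by rewrite /B; lra.
have W0 : 0 < \sum_j w ord0 j.
  rewrite lt_def sumr_ge0// andbT; apply/eqP => W0.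
  have := wg _ Ax0; rewrite W0 mul0r add0r.
  move: W0 => /eqP; rewrite psumr_eq0// => /allP W0.
  rewrite big1 ?leNgt ?e0// => j _.
  by rewrite (eqP (W0 j (mem_index_enum j))) mul0r.
have [h Gh hle] := mixable_sum mG Ggs w0 W0.
have [x Ax hx] := Gv h Gh.
have := le_trans (wg x Ax) (hle x Ax).
by rewrite leNgt; have := ler_wpM2l (ltW W0) hx; lra.
Qed.

End minimax.

(** * Discrete adversaries *)

Section ultrafilters.

Lemma ultra_map (T V : Type) (f : T -> V) (F : set_system T) :
  UltraFilter F -> UltraFilter (f @ F).
Proof.
move=> UF; split; first exact: fmap_proper_filter.
move=> G PG FG; apply/seteqP; split=> // B GB.
have [//|FnB] := in_ultra_setVsetC (f @^-1` B) UF.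
have /FG GnB : (f @ F) (~` B) by [].
have : G (B `&` ~` B) by apply: filterI.
by rewrite setICr => /filter_ex[].
Qed.

Lemma compact_ultra_cvg (T : Type) (V : topologicalType) (A : set V) (f : T -> V)
    (F : set_system T) :
  UltraFilter F -> compact A -> (\forall t \near F, A (f t)) ->
  exists2 a, A a & f t @[t --> F] --> a.
Proof.
rewrite compact_ultra => UF /(_ _ (ultra_map f UF)) cA FA.
by have [a [Aa fa]] := cA FA; exists a.
Qed.

Lemma nat_ultra : exists U : set_system nat, UltraFilter U /\ \oo `<=` U.
Proof. exact: ultraFilterLemma. Qed.

End ultrafilters.

Section atoms.
Context {R : realType} {m : nat}.
Variables (Z : set 'rV[R]_m) (cost : 'rV[R]_m -> R).
Hypothesis Zclosed : closed Z.
Hypothesis cost0 : forall z, Z z -> 0 <= cost z.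
Hypothesis cost_lsc : forall z a, Z z -> a < cost z ->
  \forall z' \near z, Z z' -> a < cost z'.
Hypothesis cost_coercive :
  exists2 M : R, 0 <= M & forall z, Z z -> `|z| <= M * (1 + cost z).

Lemma atom_limit (U : set_system nat) (p : nat -> R) (z : nat -> 'rV[R]_m)
    (B : R) :
  Z !=set0 -> UltraFilter U -> (forall j, 0 <= p j <= 1) ->
  (forall j, Z (z j)) -> (forall j, p j * cost (z j) <= B) ->
  exists (p0 : R) (z0 : 'rV[R]_m), [/\ p j @[j --> U] --> p0, Z z0,
    forall e : R, 0 < e -> \forall j \near U, p0 * cost z0 <= p j * cost (z j) + e &
    forall f : 'rV[R]_m -> R, continuous f ->
      (forall e : R, 0 < e -> exists M, forall z, Z z -> f z <= M + e * cost z) ->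
      forall e : R, 0 < e -> \forall j \near U, p j * f (z j) <= p0 * f z0 + e].
Proof.
move=> [z1 Zz1] UF p01 Zz pB.
have B0 : 0 <= B.
  by apply: le_trans (pB 0%N); case/andP: (p01 0%N) => ? _; rewrite mulr_ge0 ?cost0.
have [|p0 p0I pp0] := @compact_ultra_cvg _ R^o _ p U UF (@segment_compact R 0 1).
  by near=> j; rewrite /= in_itv/=.
move: p0I; rewrite /= in_itv/= => /andP[p0ge p0le].
have [p00|p0n] := eqVneq p0 0.
  exists p0, z1; split => //.
    move=> e e0; rewrite p00 mul0r; near=> j.
    by case/andP: (p01 j) => pj _; rewrite addr_ge0 ?mulr_ge0 ?cost0// ltW.
  move=> f _ fM e e0; rewrite p00 mul0r add0r.
  have B1 : 0 < B + 1 by rewrite ltr_wpDl.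
  have [M HM] := fM (e / 2 / (B + 1)) (divr_gt0 (divr_gt0 e0 (ltr0Sn _ 1)) B1).
  have M1 : 0 < `|M| + 1 by rewrite ltr_wpDl.
  near=> j.
  have pj : p j <= e / 2 / (`|M| + 1).
    near: j; apply: (@cvgr_le _ _ U _ p p0) => //.
    by rewrite p00 !divr_gt0.
  have /andP[pj0 _] := p01 j.
  apply: le_trans (ler_wpM2l pj0 (HM _ (Zz j))) _.
  rewrite mulrDr mulrCA.
  have H1 : p j * M <= e / 2.
    apply: le_trans (_ : p j * (`|M| + 1) <= _).
      by rewrite ler_wpM2l// ler_wpDr// ler_norm.
    by rewrite -ler_pdivlMr.
  have H2 : e / 2 / (B + 1) * (p j * cost (z j)) <= e / 2.
    rewrite -mulrA ger_pMr ?divr_gt0// mulrC ler_pdivrMr// mul1r.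
    by apply: le_trans (pB j) _; rewrite lerDl.
  by lra.
have p0gt : 0 < p0 by rewrite lt_def p0n.
have [M M0 HM] := cost_coercive.
pose C := M * (1 + B / (p0 / 2)).
have nearp : \forall j \near U, p0 / 2 <= p j.
  by apply: (@cvgr_ge _ _ U _ p p0) => //; lra.
have cA : compact (Z `&` [set z : 'rV[R]_m | `|z| <= C]).
  apply: bounded_closed_compact.
    exists C; split; first exact: num_real.
    by move=> x Cx y [_ /= yC]; exact: le_trans (ltW Cx).
  by apply: closedI => //; apply: closed_sublevel; exact: norm_continuous.
have [|z0 [Zz0 _] zz0] := @compact_ultra_cvg _ _ _ z U UF cA.
  near=> j; split => //=.
  apply: le_trans (HM _ (Zz j)) _; rewrite ler_wpM2l// lerD2l.
  rewrite ler_pdivlMr ?divr_gt0// mulrC.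
  apply: le_trans (pB j); rewrite ler_wpM2r ?cost0//.
  by near: j.
exists p0, z0; split => //.
  move=> e e0.
  pose a := cost z0 - e / 2.
  have ac : a < cost z0 by rewrite /a; lra.
  near=> j.
  have caj : a < cost (z j).
    have : Z (z j) -> a < cost (z j) by near: j; exact: zz0 (cost_lsc Zz0 ac).
    by apply.
  have paj : p0 * a - e / 2 <= p j * a.
    near: j; apply: (@cvgr_ge _ _ U _ (fun j => p j * a) (p0 * a)).
      by apply: cvgMl; exact: pp0.
    by lra.
  have := ler_wpM2l (proj1 (andP (p01 j))) (ltW caj).
  by move: paj; rewrite /a; nra.
move=> f cf _ e e0.
have : (fun j => p j * f (z j)) @ U --> p0 * f z0.
  by apply: cvgM => //; apply: (cvg_comp _ _ zz0); exact: cf.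
by move=> /cvgr_le; apply; lra.
Unshelve. all: by end_near. Qed.

End atoms.

Section discrete_strategies.
Context {R : realType} {n m N K : nat}.
Variables (Z : set 'rV[R]_m) (c : 'rV[R]_m -> 'rV[R]_m -> R).
Variables (zhat : 'I_N -> 'rV[R]_m) (ellk : 'I_K -> 'rV[R]_n -> 'rV[R]_m -> R).

(* A discrete adversary splits the mass [1/N] of the sample [zhat i] among [K]
   atoms, the [k]-th of which is only charged to the [k]-th piece of the loss:
   the payoff is then jointly concave (up to perspective) in [(p, p z)]. *)
Definition feasible (rho : R) (p : 'I_N -> 'I_K -> R)
    (z : 'I_N -> 'I_K -> 'rV[R]_m) : Prop :=
  [/\ forall i k, 0 <= p i k, forall i, \sum_k p i k = N%:R^-1,
      forall i k, Z (z i k) &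
      \sum_i \sum_k p i k * c (z i k) (zhat i) <= rho].

Definition payoff (p : 'I_N -> 'I_K -> R) (z : 'I_N -> 'I_K -> 'rV[R]_m)
    (x : 'rV[R]_n) : R :=
  \sum_i \sum_k p i k * ellk k x (z i k).

Definition payoffs (rho : R) : set ('rV[R]_n -> R) :=
  [set g | exists p z, feasible rho p z /\ g = payoff p z].

Lemma merge_atoms (z1 z2 : 'rV[R]_m) (a b : R) :
  convex_set Z -> Z z1 -> Z z2 -> 0 <= a -> 0 <= b ->
  exists z, Z z /\ forall D (f : 'rV[R]_m -> R), convex_function D f ->
    D z1 -> D z2 -> (a + b) * f z <= a * f z1 + b * f z2.
Proof.
move=> /convex_setP cZ Z1 Z2 a0 b0.
have [ab0|abn0] := eqVneq (a + b) 0.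
  move/eqP: (ab0); rewrite paddr_eq0// => /andP[/eqP -> /eqP ->].
  by exists z1; split=> // D f _ _ _; rewrite addr0 !mul0r addr0.
have ab : 0 < a + b by rewrite lt_def abn0 addr_ge0.
have ha : 0 <= a / (a + b) by rewrite divr_ge0// ltW.
have hb : 0 <= b / (a + b) by rewrite divr_ge0// ltW.
have hab : a / (a + b) + b / (a + b) = 1 by rewrite -mulrDl divff.
exists ((a / (a + b)) *: z1 + (b / (a + b)) *: z2); split; first exact: cZ.
move=> D f /convex_functionP cf D1 D2.
have := cf _ _ _ _ D1 D2 ha hb hab.
rewrite -(ler_pM2l ab) => /le_trans; apply.
by rewrite le_eqVlt; apply/orP; left; apply/eqP; field.
Qed.

Hypothesis Zconv : convex_set Z.
Hypothesis c_convex : forall i, convex_function Z (c ^~ (zhat i)).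
Hypothesis ellk_convex : forall k z,
  convex_function [set: 'rV[R]_n] (fun x => ellk k x z).
Hypothesis ellk_concave : forall k x,
  convex_function [set: 'rV[R]_m] (fun z => - ellk k x z).

Lemma payoffs_mixable rho : mixable setT (payoffs rho).
Proof.
move=> _ _ a b [p1 [z1 [[p10 p1N Z1 c1] ->]]] [p2 [z2 [[p20 p2N Z2 c2] ->]]].
move=> a0 b0 ab.
pose p i k := a * p1 i k + b * p2 i k.
have /choice[z /all_and2[Zz hz]] (ik : 'I_N * 'I_K) : exists z, Z z /\
    forall D (f : 'rV[R]_m -> R), convex_function D f ->
    D (z1 ik.1 ik.2) -> D (z2 ik.1 ik.2) ->
    p ik.1 ik.2 * f z <= a * p1 ik.1 ik.2 * f (z1 ik.1 ik.2) +
                         b * p2 ik.1 ik.2 * f (z2 ik.1 ik.2).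
  by apply: merge_atoms => //; rewrite mulr_ge0.
exists (payoff p (fun i k => z (i, k))).
  exists p, (fun i k => z (i, k)); split => //; split => //.
  - by move=> i k; rewrite addr_ge0// mulr_ge0.
  - by move=> i; rewrite big_split/= -!big_distrr/= p1N p2N -mulrDl ab mul1r.
  - apply: (@le_trans _ _ (a * rho + b * rho)); last by rewrite -mulrDl ab mul1r.
    apply: le_trans (lerD (ler_wpM2l a0 c1) (ler_wpM2l b0 c2)).
    rewrite !big_distrr -big_split ler_sum//= => i _.
    rewrite !big_distrr -big_split ler_sum//= => k _.
    rewrite !mulrA; exact: (hz (i, k) _ _ (c_convex i)).
move=> x _; rewrite !big_distrr -big_split ler_sum//= => i _.
rewrite !big_distrr -big_split ler_sum//= => k _.
have := hz (i, k) _ _ (ellk_concave k x) I I.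
by rewrite /= !mulrN -opprD lerN2 !mulrA.
Qed.

Lemma payoffs_convex rho g :
  payoffs rho g -> convex_function [set: 'rV[R]_n] g.
Proof.
move=> [p [z [[p0 _ _ _] ->]]]; apply/convex_functionP => x y a b _ _ a0 b0 ab.
rewrite !big_distrr -big_split ler_sum//= => i _.
rewrite !big_distrr -big_split ler_sum//= => k _.
have /convex_functionP/(_ x y a b I I a0 b0 ab) := ellk_convex k (z i k).
by move=> /(ler_wpM2l (p0 i k)) /le_trans; apply; rewrite mulrDr; lra.
Qed.

Variable X : set 'rV[R]_n.
Hypothesis Zclosed : closed Z.
Hypothesis zhatZ : forall i, Z (zhat i).
Hypothesis c0 : forall i z, Z z -> 0 <= c z (zhat i).
Hypothesis c_lsc : forall i z a, Z z -> a < c z (zhat i) ->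
  \forall z' \near z, Z z' -> a < c z' (zhat i).
Hypothesis c_coercive : forall i,
  exists2 M : R, 0 <= M & forall z, Z z -> `|z| <= M * (1 + c z (zhat i)).
Hypothesis ellk_growth : forall i k x, X x -> forall e : R, 0 < e ->
  exists M, forall z, Z z -> ellk k x z <= M + e * c z (zhat i).

Lemma feasible_le1 rho p z i k : feasible rho p z -> p i k <= 1.
Proof.
case=> p0 pN _ _; apply: (@le_trans _ _ N%:R^-1).
  by rewrite -(pN i) (bigD1 k)//= lerDl sumr_ge0.
have N0 : (0 < N)%N by exact: leq_ltn_trans (ltn_ord i).
by rewrite invf_le1 ?ltr0n// ler1n.
Qed.

Lemma feasible_cost_le rho p z i k :
  feasible rho p z -> p i k * c (z i k) (zhat i) <= rho.
Proof.
case=> p0 pN Zz; apply: le_trans.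
have h i' k' : 0 <= p i' k' * c (z i' k') (zhat i') by rewrite mulr_ge0 ?c0.
by rewrite (bigD1 i)//= (bigD1 k)//= -addrA lerDl addr_ge0// ?sumr_ge0// => *;
  rewrite sumr_ge0.
Qed.

Lemma feasible_limit rho (p : nat -> 'I_N -> 'I_K -> R)
    (z : nat -> 'I_N -> 'I_K -> 'rV[R]_m) :
  (forall j, feasible (rho + j.+1%:R^-1) (p j) (z j)) ->
  exists p0 z0, feasible rho p0 z0 /\ forall x v, X x ->
    (forall j, v - j.+1%:R^-1 <= payoff (p j) (z j) x) -> v <= payoff p0 z0 x.
Proof.
move=> fq; have [U [UF ooU]] := nat_ultra.
have invU (e : R) : 0 < e -> \forall j \near U, j.+1%:R^-1 <= e :> R.
  move=> e0; apply: ooU.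
  by have /cvgr_le/(_ _ e0) := @cvg_harmonic R.
have lim (ik : 'I_N * 'I_K) : exists pz : R * 'rV[R]_m,
  [/\ p j ik.1 ik.2 @[j --> U] --> pz.1, Z pz.2,
    forall e : R, 0 < e -> \forall j \near U, pz.1 * c pz.2 (zhat ik.1) <=
       p j ik.1 ik.2 * c (z j ik.1 ik.2) (zhat ik.1) + e &
    forall f : 'rV[R]_m -> R, continuous f ->
      (forall e : R, 0 < e -> exists M, forall z, Z z ->
        f z <= M + e * c z (zhat ik.1)) ->
      forall e : R, 0 < e -> \forall j \near U,
        p j ik.1 ik.2 * f (z j ik.1 ik.2) <= pz.1 * f pz.2 + e].
  have [|||| p0 [z0 h]] := @atom_limit _ _ Z (c ^~ (zhat ik.1)) Zclosed
    (@c0 ik.1) (@c_lsc ik.1) (c_coercive ik.1) U (fun j => p j ik.1 ik.2)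
    (fun j => z j ik.1 ik.2) (rho + 1) _ UF; last by exists (p0, z0).
  - by exists (zhat ik.1).
  - by move=> j; rewrite (feasible_le1 _ _ (fq j)) andbT; case: (fq j).
  - by move=> j; case: (fq j).
  - move=> j; apply: le_trans (feasible_cost_le _ _ (fq j)) _.
    by rewrite lerD2l invf_le1 ?ltr0n// ler1n.
have {lim} /choice[pz /all_and4[pp Zz cz fz]] := lim.
pose p0 i k := (pz (i, k)).1; pose z0 i k := (pz (i, k)).2.
pose D : R := (N * K)%:R + 1.
have D0 : 0 < D by rewrite ltr_wpDl.
have sumD (e : R) : \sum_(i < N) \sum_(k < K) e / D + e / D = e.
  rewrite !(sumr_const, card_ord) -mulrnA -mulr_natl mulnC.
  by rewrite -[X in _ + X]mul1r -mulrDl mulrC divfK// gt_eqF.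
exists p0, z0; split.
  split.
  - move=> i k; rewrite leNgt; apply/negP => lt0.
    have /cvgr_lt/(_ 0 lt0)/filter_ex[j] := pp (i, k).
    by rewrite ltNge; case: (fq j) => ->.
  - move=> i; have : \sum_k p j i k @[j --> U] --> \sum_k p0 i k.
      by apply: cvg_sumr => k _; exact: (pp (i, k)).
    have -> : (fun j => \sum_k p j i k) = (fun=> N%:R^-1).
      by apply/funext => j; case: (fq j).
    by move=> /(cvg_unique _ (cvg_cst _))/esym; apply; exact: norm_hausdorff.
  - by move=> i k; exact: Zz.
  - apply/ler_addgt0Pr => e e0; have eD : 0 < e / D by rewrite divr_gt0.
    have [j [jc je]] : exists j,
        (forall ik, p0 ik.1 ik.2 * c (z0 ik.1 ik.2) (zhat ik.1) <=
           p j ik.1 ik.2 * c (z j ik.1 ik.2) (zhat ik.1) + e / D) /\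
        j.+1%:R^-1 <= e / D.
      apply: (@filter_ex _ U); apply: filterI; last exact: invU.
      by apply: filter_forall => -[i k]; exact: (cz (i, k)).
    rewrite -(sumD e) addrCA.
    apply: (@le_trans _ _ (\sum_i \sum_k
        (p j i k * c (z j i k) (zhat i) + e / D))).
      by apply: ler_sum => i _; apply: ler_sum => k _; exact: (jc (i, k)).
    under eq_bigr do rewrite big_split/=.
    rewrite big_split/= [leRHS]addrC lerD2r.
    by case: (fq j) => _ _ _ /le_trans; apply; rewrite lerD2l.
move=> x v Xx vle; apply/ler_addgt0Pr => e e0.
have eD : 0 < e / D by rewrite divr_gt0.
have [j [jc je]] : exists j,
    (forall ik, p j ik.1 ik.2 * ellk ik.2 x (z j ik.1 ik.2) <=
       p0 ik.1 ik.2 * ellk ik.2 x (z0 ik.1 ik.2) + e / D) /\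
    j.+1%:R^-1 <= e / D.
  apply: (@filter_ex _ U); apply: filterI; last exact: invU.
  apply: filter_forall => -[i k]; apply: (fz (i, k)) => //.
    exact: concave_continuous (ellk_concave k x).
  by move=> e' e'0; exact: ellk_growth.
have := vle j; rewrite lerBlDr => /le_trans; apply.
rewrite -(sumD e) addrA lerD//.
rewrite -big_split ler_sum//= => i _; rewrite -big_split ler_sum//= => k _.
exact: (jc (i, k)).
Unshelve. all: by end_near. Qed.

End discrete_strategies.

(** * Jensen's inequality for barycenters *)

Section borel.
Context {R : realType} {m : nat}.
Local Notation T := (borel_rV R m).

Lemma open_measurable_rV (A : set 'rV[R]_m) :
  open A -> measurable (A : set T).
Proof. by move=> oA; exact: sub_sigma_algebra. Qed.

Lemma closed_measurable_rV (A : set 'rV[R]_m) :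
  closed A -> measurable (A : set T).
Proof.
by move=> cA; rewrite -[A]setCK; apply: measurableC; apply: open_measurable_rV;
  exact: closed_openC.
Qed.

Lemma lsc_measurable_fun (D : set 'rV[R]_m) (f : 'rV[R]_m -> R) :
  (forall z a, D z -> a < f z -> \forall z' \near z, D z' -> a < f z') ->
  measurable_fun (D : set T) (f : T -> R).
Proof.
move=> lscf mD; apply: (measurability _ (RGenOInfty.measurableE R)) => //.
move=> /= _ [_ [a ->] <-].
pose O := interior [set z | D z -> a < f z].
rewrite (_ : _ `&` _ = D `&` O); last first.
  apply/seteqP; split=> z /=; rewrite in_itv/= andbT => -[Dz].
    by move=> az; split => //; exact: lscf.
  by move=> /interior_subset/(_ Dz).
by apply: measurableI => //; apply: open_measurable_rV; exact: open_interior.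
Qed.

Lemma continuous_measurable_rV (f : 'rV[R]_m -> R) :
  continuous f -> measurable_fun setT (f : T -> R).
Proof.
move=> cf; apply: lsc_measurable_fun => z a _ az.
have H := @cvgr_gt _ _ (nbhs z) _ f (f z) (cf z) a az.
near=> z' => _; near: z'; exact: H.
Unshelve. all: by end_near.
Qed.

End borel.

Section integrals.
Context d (T : measurableType d) (R : realType).
Variable mu : {measure set T -> \bar R}.

(* No measurability: the integral of a nonnegative function is a supremum
   over the simple functions below it. *)
Lemma ge0_subset_integral_any (D E : set T) (f : T -> \bar R) :
  D `<=` E -> (forall x, E x -> (0 <= f x)%E) ->
  (\int[mu]_(x in D) f x <= \int[mu]_(x in E) f x)%E.
Proof.
move=> DE f0; rewrite !ge0_integralE//; last by move=> x /DE; exact: f0.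
apply: ereal_sup_le => _ [h hf <-]; exists h => // x /=.
apply: le_trans (hf x) _; rewrite !patchE.
case: ifPn => [/set_mem/DE Ex|_]; first by rewrite mem_set.
by case: ifPn => // /set_mem /f0.
Qed.

Lemma Rintegral_sum (I : Type) (r : seq I) (D : set T) (h : I -> T -> R) :
  measurable D -> (forall i, mu.-integrable D (EFin \o h i)) ->
  \int[mu]_(x in D) (\sum_(i <- r) h i x) = \sum_(i <- r) \int[mu]_(x in D) h i x.
Proof.
move=> mD ih; elim: r => [|i r IH].
  rewrite big_nil (@eq_Rintegral _ _ _ _ _ (cst 0)) => [|x _].
    by rewrite Rintegral_cst// mul0r.
  by rewrite big_nil.
rewrite big_cons -IH -RintegralD//.
  by apply: eq_Rintegral => x _; rewrite big_cons.
rewrite (_ : _ \o _ = fun x => (\sum_(j <- r) (EFin \o h j) x)%R).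
  exact: integrable_sum.
by apply/funext => x /=; rewrite sumEFin.
Qed.

Lemma Rintegral_partition_of_unity (I : finType) (a : I -> R) (E : I -> set T)
    (D : set T) (h : T -> R) :
  measurable D -> (forall i, measurable (E i)) -> (forall i, E i `<=` D) ->
  (forall u, D u -> \sum_i a i * \1_(E i) u = 1) ->
  mu.-integrable D (EFin \o h) ->
  \int[mu]_(x in D) h x = \sum_i a i * \int[mu]_(x in E i) h x.
Proof.
move=> mD mE ED a1 ih.
have hE i : h \_ (E i) = (fun x => h x * \1_(E i) x).
  by apply/funext => x; rewrite patchE indicE; case: (x \in E i);
    rewrite ?mulr1 ?mulr0.
have ihE i : mu.-integrable D (EFin \o (h \_ (E i))).
  rewrite (_ : _ \o _ = (EFin \o h) \_ (E i)); last first.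
    by apply/funext => x; rewrite /= !patchE; case: ifP.
  by rewrite -integrable_restrict// (setIidr (ED i)); exact: integrableS ih.
transitivity (\int[mu]_(x in D) (\sum_i a i * (h \_ (E i)) x)).
  apply: eq_Rintegral => x /set_mem Dx.
  rewrite -[LHS]mulr1 -(a1 x Dx) big_distrr; apply: eq_bigr => i _ /=.
  by rewrite hE; ring.
rewrite Rintegral_sum//; last first.
  move=> i; rewrite (_ : _ \o _ = fun x => ((a i)%:E * (EFin \o (h \_ (E i))) x)%E).
    exact: integrableZl.
  by apply/funext.
apply: eq_bigr => i _; rewrite RintegralZl//.
by rewrite -Rintegral_mkcondr (setIidr (ED i)).
Qed.

End integrals.

Section barycenter.
Context d (T : measurableType d) (R : realType).
Variable mu : {finite_measure set T -> \bar R}.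

Lemma barycenter_mem (k : nat) (S : set 'rV[R]_k) (E : set T)
    (f : T -> 'rV[R]_k) :
  closed S -> convex_set S -> measurable E ->
  0 < fine (mu E) ->
  (forall j, mu.-integrable E (fun u => (f u ord0 j)%:E)) ->
  (forall u, E u -> S (f u)) ->
  S (\row_j (\int[mu]_(u in E) f u ord0 j / fine (mu E))).
Proof.
move=> clS cvS mE p0 fi fS; apply: contrapT => Sb.
have [w [e [e0 we]]] := strict_separation clS cvS Sb.
set b := \row_j _ in Sb we.
have iwf j : mu.-integrable E (EFin \o (fun u => w ord0 j * f u ord0 j)).
  rewrite (_ : _ \o _ = fun u => ((w ord0 j)%:E * (f u ord0 j)%:E)%E).
    exact: integrableZl.
  by apply/funext.
have : \int[mu]_(u in E) (dotv w b + e) <= \int[mu]_(u in E) dotv w (f u).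
  apply: le_Rintegral => //.
  - exact: finite_measure_integrable_cst.
  - rewrite (_ : _ \o _ = fun u =>
        (\sum_j (EFin \o (fun u => w ord0 j * f u ord0 j)) u)%R).
      exact: integrable_sum.
    by apply/funext => u /=; rewrite sumEFin.
  - by move=> u /fS /we.
rewrite Rintegral_cst// Rintegral_sum//.
have -> : \sum_j \int[mu]_(u in E) (w ord0 j * f u ord0 j) =
    dotv w b * fine (mu E).
  rewrite /dotv big_distrl; apply: eq_bigr => j _ /=.
  rewrite RintegralZl//; last exact: fi.
  by rewrite /b mxE -mulrA divfK// gt_eqF.
by rewrite ler_pM2r// gerDl leNgt e0.
Qed.

End barycenter.

Section jensen.
Context {R : realType} {m : nat}.
Variables (Z : set 'rV[R]_m) (cost L : 'rV[R]_m -> R).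
Hypotheses (Zclosed : closed Z) (Zconv : convex_set Z).
Hypothesis cost_convex : convex_function Z cost.
Hypothesis cost_lsc : forall z a, Z z -> a < cost z ->
  \forall z' \near z, Z z' -> a < cost z'.
Hypothesis L_concave : convex_function [set: 'rV[R]_m] (fun z => - L z).

Let s0 : 'I_(m + 2) := rshift m ord0.
Let s1 : 'I_(m + 2) := rshift m ord_max.

Let graph : set 'rV[R]_(m + 2) := [set y |
  [/\ Z (lsubmx y), cost (lsubmx y) <= y ord0 s0 & y ord0 s1 <= L (lsubmx y)]].

Let graph_closed : closed graph.
Proof.
move=> y cly.
have cl P : (\forall y' \near nbhs y, P y') -> exists2 y', graph y' & P y'.
  by move=> /cly[y' [gy' Py']]; exists y'.
have ls := @continuous_lsubmx R m 2 y.
have Zy : Z (lsubmx y).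
  apply: contrapT => nZ.
  have nZ' : nbhs (lsubmx y) (~` Z).
    by apply: open_nbhs_nbhs; split=> //; exact: closed_openC.
  by have [y' []] := cl _ (ls _ nZ').
split => //.
  rewrite leNgt; apply/negP => yc.
  pose a := (y ord0 s0 + cost (lsubmx y)) / 2.
  have ya : y ord0 s0 < a by rewrite /a; lra.
  have ac : a < cost (lsubmx y) by rewrite /a; lra.
  have H1 : \forall y' \near nbhs y, Z (lsubmx y') -> a < cost (lsubmx y').
    exact: ls _ (cost_lsc Zy ac).
  have H2 : \forall y' \near nbhs y, (y' : 'rV[R]_(m + 2)) ord0 s0 < a.
    apply: (@cvgr_lt _ _ (nbhs y) _ (fun u : 'rV[R]_(m + 2) => u ord0 s0)
      (y ord0 s0)) => //.
    exact: coord_continuous.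
  have [y' [Zy' cy' _] [/(_ Zy') acy' ya']] := cl _ (filterI H1 H2).
  by have := lt_trans (lt_le_trans acy' cy') ya'; rewrite ltxx.
rewrite -subr_le0.
have cLs : continuous (fun u : 'rV[R]_(m + 2) => u ord0 s1 - L (lsubmx u)).
  move=> u; apply: continuousB; first exact: coord_continuous.
  apply: continuous_comp; first exact: continuous_lsubmx.
  exact: concave_continuous L_concave _.
apply: (closed_sublevel (a := 0) cLs) => B /cly[y' [[_ _ Ly'] By']].
by exists y'; split => //=; rewrite subr_le0.
Qed.

Let graph_convex : convex_set graph.
Proof.
apply/convex_setP => y y' a b [Zy cy Ly] [Zy' cy' Ly'] a0 b0 ab.
have lE : lsubmx (a *: y + b *: y') = a *: lsubmx y + b *: lsubmx y'.
  by apply/rowP => j; rewrite !mxE.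
rewrite /graph /= lE; split.
- by move/convex_setP : Zconv; apply.
- move/convex_functionP : cost_convex => /(_ _ _ a b Zy Zy' a0 b0 ab).
  by move=> /le_trans; apply; rewrite !mxE lerD// ler_wpM2l.
- move/convex_functionP : L_concave => /(_ (lsubmx y) (lsubmx y') a b I I a0 b0 ab).
  rewrite lerNl => H; apply: le_trans H; rewrite !mulrN -opprD opprK.
  by rewrite !mxE lerD// ler_wpM2l.
Qed.

Lemma conditional_mean d (T : measurableType d)
    (mu : {finite_measure set T -> \bar R}) (E : set T) (g : T -> 'rV[R]_m) :
  Z !=set0 -> measurable E -> (forall u, E u -> Z (g u)) ->
  (forall j, mu.-integrable E (fun u => (g u ord0 j)%:E)) ->
  mu.-integrable E (EFin \o (cost \o g)) -> mu.-integrable E (EFin \o (L \o g)) ->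
  exists2 z, Z z & fine (mu E) * cost z <= \int[mu]_(u in E) cost (g u) /\
    \int[mu]_(u in E) L (g u) <= fine (mu E) * L z.
Proof.
move=> [z1 Zz1] mE EZ gi ci Li.
have : 0 <= fine (mu E) by exact: fine_ge0.
rewrite le_eqVlt => /predU1P[p0|p0].
  have muE0 : mu E = 0%E.
    by rewrite -[LHS]fineK ?fin_num_measure// -p0.
  have int0 h : mu.-integrable E (EFin \o h) -> \int[mu]_(u in E) h u = 0.
    by move=> /integrableP[mh _]; rewrite /Rintegral null_set_integral.
  by exists z1 => //; rewrite -p0 !mul0r !int0.
pose f u : 'rV[R]_(m + 2) :=
  row_mx (g u) (\row_(i < 2) if i == ord0 then cost (g u) else L (g u)).
have fl u j : f u ord0 (lshift 2 j) = g u ord0 j by rewrite row_mxEl.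
have f0 u : f u ord0 s0 = cost (g u) by rewrite row_mxEr mxE.
have f1 u : f u ord0 s1 = L (g u) by rewrite row_mxEr mxE.
have fi j : mu.-integrable E (fun u => (f u ord0 j)%:E).
  rewrite -(splitK j); case: (fintype.split j) => /= i.
    by under [X in _.-integrable _ X]funext do rewrite fl.
  case: (unliftP ord0 i) => [k ->|->]; last first.
    by under [X in _.-integrable _ X]funext do rewrite -[rshift _ _]/s0 f0.
  have -> : lift ord0 k = ord_max by apply/val_inj; rewrite /= (ord1 k).
  by under [X in _.-integrable _ X]funext do rewrite -[rshift _ _]/s1 f1.
have [|Zz cz Lz] := barycenter_mem graph_closed graph_convex mE p0 fi.
  move=> u /EZ Zu; rewrite /graph /= f0 f1.
  by have -> : lsubmx (f u) = g u by rewrite row_mxKl.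
set z := lsubmx _ in Zz cz Lz; exists z => //; split.
  move: cz; rewrite mxE; under eq_Rintegral do rewrite f0.
  by rewrite ler_pdivlMr// mulrC.
move: Lz; rewrite mxE; under eq_Rintegral do rewrite f1.
by rewrite ler_pdivrMr// mulrC.
Qed.

End jensen.

Section first_argmax.
Context {R : realType} {m K : nat}.
Variable L : 'I_K -> 'rV[R]_m -> R.
Hypothesis cL : forall k, continuous (L k).

Definition first_argmax (k : 'I_K) : set (borel_rV R m) :=
  [set z | (forall k', L k' z <= L k z) /\
           forall k' : 'I_K, (k' < k)%N -> L k' z < L k z].

Lemma measurable_first_argmax k : measurable (first_argmax k).
Proof.
have mle i j : measurable ([set z | L i z <= L j z] : set (borel_rV R m)).
  apply: closed_measurable_rV.
  have cB : continuous (fun z => L i z - L j z).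
    by move=> z; apply: continuousB; exact: cL.
  rewrite (_ : [set _ | _] = [set z | L i z - L j z <= 0]); last first.
    by apply/seteqP; split=> z /=; rewrite subr_le0.
  exact: closed_sublevel.
rewrite (_ : first_argmax k =
    \bigcap_(k' in [set: 'I_K]) [set z | L k' z <= L k z] `&`
    \bigcap_(k' in [set k' : 'I_K | (k' < k)%N]) ~` [set z | L k z <= L k' z]).
  apply: measurableI; apply: fin_bigcap_measurable => // k' _.
  exact: measurableC.
apply/seteqP; split=> z [H1 H2]; split.
- by move=> k' _; exact: H1.
- by move=> k' /H2 /=; rewrite ltNge => /negP.
- by move=> k'; exact: H1.
- by move=> k' /H2 /=; rewrite ltNge => /negP.
Qed.

Lemma sum_indic_first_argmax z :
  (0 < K)%N -> \sum_k \1_(first_argmax k) z = 1 :> R.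
Proof.
move=> K0; pose k0 := Ordinal K0.
pose isM (k : 'I_K) := [forall k', L k' z <= L k z].
have [k1 k1M] : exists k, isM k.
  case: (Order.TotalTheory.arg_maxP (fun k => L k z) (isT : xpredT k0)) => k _ H.
  by exists k; apply/forallP => k'; exact: H.
case: (arg_minnP (fun k : 'I_K => k : nat) k1M) => k /forallP kM kmin.
have Ak : first_argmax k z.
  split=> // k' k'k; rewrite lt_neqAle kM andbT; apply/eqP => e.
  have : isM k' by apply/forallP => j; rewrite e.
  by move=> /kmin; rewrite leqNgt k'k.
rewrite (bigD1 k)//= indicE mem_set// big1 ?addr0// => k' k'k.
rewrite indicE memNset// => -[M1 M2].
case: (ltngtP k k') => kk'.
- by have := M2 _ kk'; rewrite ltNge kM.
- by case: Ak => _ /(_ _ kk'); rewrite ltNge M1.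
- by move/eqP: k'k; apply; apply/val_inj.
Qed.

End first_argmax.

Section coupling_integral.
Context {R : realType} {m : nat}.
Local Notation T := (borel_rV R m).
Variables (Q : {measure set T -> \bar R}) (gamma : probability (T * T)%type R).
Hypothesis Qgamma : forall A : set T, measurable A -> pushforward gamma fst A = Q A.

Lemma integral_marginal (f : T -> \bar R) :
  measurable_fun [set: T] f -> (\int[Q]_z f z = \int[gamma]_u f u.1)%E.
Proof.
have ge0 (g : T -> \bar R) : measurable_fun [set: T] g -> (forall z, 0 <= g z)%E ->
    (\int[Q]_z g z = \int[gamma]_u g u.1)%E.
  move=> mg g0.
  rewrite -(@ge0_integral_pushforward _ _ _ _ _ fst measurable_fst gamma setT g)//.
  by apply: eq_measure_integral => A mA _; rewrite -Qgamma.
move=> mf; rewrite [LHS]integralE [RHS]integralE.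
rewrite (ge0 _ (measurable_funepos mf)) ?(ge0 _ (measurable_funeneg mf)) //.
by congr (_ - _)%E; apply: eq_integral => u _; rewrite ?funeposE ?funenegE.
Qed.

End coupling_integral.

(** * From distributions to discrete adversaries *)

Section compression.
Context {R : realType} {n m N K : nat}.
Local Notation T := (borel_rV R m).
Variables (Z : set 'rV[R]_m) (c : 'rV[R]_m -> 'rV[R]_m -> R).
Variables (zhat : 'I_N -> 'rV[R]_m) (ellk : 'I_K -> 'rV[R]_n -> 'rV[R]_m -> R).
Variable ell : 'rV[R]_n -> 'rV[R]_m -> R.
Hypothesis K0 : (0 < K)%N.
Hypotheses (Zclosed : closed Z) (Zconv : convex_set Z).
Hypothesis zhatZ : forall i, Z (zhat i).
Hypothesis c0 : forall z zh, Z z -> Z zh -> 0 <= c z zh.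
Hypothesis c_convex : forall i, convex_function Z (c ^~ (zhat i)).
Hypothesis c_lsc : forall i z a, Z z -> a < c z (zhat i) ->
  \forall z' \near z, Z z' -> a < c z' (zhat i).
Hypothesis c_coercive : forall i,
  exists2 M : R, 0 <= M & forall z, Z z -> `|z| <= M * (1 + c z (zhat i)).
Hypothesis ellk_concave : forall k x,
  convex_function [set: 'rV[R]_m] (fun z => - ellk k x z).
Hypothesis ell_max :
  forall x z, is_maximum [set ellk k x z | k in [set: 'I_K]] (ell x z).

Lemma measurable_loss x : measurable_fun [set: T] (ell x).
Proof.
apply: lsc_measurable_fun => z a _ az.
have [[k _ kz] _] := ell_max x z.
have H := @cvgr_gt _ _ (nbhs z) _ (ellk k x) (ellk k x z)
  (concave_continuous (ellk_concave k x) (x := z)) a.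
rewrite kz in H; have {}H := H _ az.
near=> z' => _; apply: (@lt_le_trans _ _ (ellk k x z')).
  by near: z'; exact: H.
by have [_] := ell_max x z'; apply; exists k.
Unshelve. all: by end_near. Qed.

Let mult i : R := #|[pred j | zhat j == zhat i]|%:R.

Let mult_gt0 i : 0 < mult i.
Proof. by rewrite ltr0n; apply/card_gt0P; exists i; rewrite inE. Qed.

Let sum_mult z : range zhat z ->
  \sum_i (mult i)^-1 * \1_[set zhat i] z = 1.
Proof.
move=> [i0 _ <-].
rewrite (bigID (fun i => zhat i == zhat i0))/= [X in _ + X]big1 ?addr0.
  rewrite (eq_bigr (fun=> (mult i0)^-1)) => [|i /eqP ii0]; last first.
    by rewrite indicE mem_set// mulr1 /mult ii0.
  rewrite sumr_const -[LHS]mulr_natl.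
  exact: mulfV (lt0r_neq0 (mult_gt0 i0)).
move=> i ii0; rewrite indicE memNset ?mulr0// => /= e.
by move: ii0; rewrite e eqxx.
Qed.

Let empirical1 i : empirical zhat [set zhat i] = (N%:R^-1 * mult i)%:E.
Proof.
rewrite /empirical EFinM; congr (_ * _)%E.
rewrite /mult -sum1_card natr_sum -sumEFin [RHS]big_mkcond/=.
apply: eq_bigr => j _; rewrite diracE inE/=.
case: (eqVneq (zhat j) (zhat i)) => [->|ji]; first by rewrite mem_set.
by rewrite memNset//; exact/eqP.
Qed.

Let empiricalC : empirical zhat (~` range zhat) = 0%E.
Proof.
rewrite /empirical big1 ?mule0// => i _.
by rewrite diracE memNset//=; apply; exists i.
Qed.

Section fixed_coupling.
Variables (Q : probability T R) (gamma : probability (T * T)%type R).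
Hypothesis QZ : Q (Z : set T) = 1%E.
Hypothesis Qgamma : coupling Q (empirical zhat) gamma.

Let D : set (T * T) := (Z : set T) `*` (range zhat : set T).

Let mZ : measurable (Z : set T).
Proof. exact: closed_measurable_rV. Qed.

Let m1 i : measurable ([set zhat i] : set T).
Proof.
apply: closed_measurable_rV; apply: accessible_closed_set1.
by apply: hausdorff_accessible; exact: norm_hausdorff.
Qed.

Let mrange : measurable (range zhat : set T).
Proof.
rewrite (_ : range zhat = \bigcup_(i in [set: 'I_N]) [set zhat i]); last first.
  by apply/seteqP; split => [_ [i _ <-]|z [i _ ->]]; exists i.
exact: fin_bigcup_measurable.
Qed.

Let mD : measurable D. Proof. exact: measurableX. Qed.

Let gamma_fstC : gamma (fst @^-1` (~` (Z : set T))) = 0%E.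
Proof.
have [] := Qgamma (measurableC mZ); rewrite /pushforward => -> _.
by have := @probability_setC _ _ _ Q _ mZ; rewrite QZ subee.
Qed.

Let gammaDC : gamma (~` D) = 0%E.
Proof.
apply/eqP; rewrite -measure_le0.
pose A1 := fst @^-1` (~` (Z : set T)) : set (T * T).
pose A2 := snd @^-1` (~` range zhat) : set (T * T).
rewrite (_ : ~` D = A1 `|` A2).
  have A20 : gamma A2 = 0%E.
    by have [_ H] := Qgamma (measurableC mrange); exact: etrans H empiricalC.
  have : (gamma (A1 `|` A2) <= gamma A1 + gamma A2)%E.
    apply: measureU2; rewrite -[X in measurable X]setTI.
    - by apply: measurable_fst => //; exact: measurableC.
    - by apply: measurable_snd => //; exact: measurableC.
  by rewrite A20 gamma_fstC adde0.
apply/seteqP; split=> u.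
  by move=> /not_andP[]; [left|right].
by move=> [] uN [Zu ru]; exact: uN.
Qed.

Let gamma_slice i : gamma ((Z : set T) `*` [set zhat i]) = (N%:R^-1 * mult i)%:E.
Proof.
have [_ H] := Qgamma (m1 i); rewrite -[RHS](etrans H (empirical1 i)).
have mf : measurable (fst @^-1` (Z : set T) : set (T * T)).
  by rewrite -[X in measurable X]setTI; exact: measurable_fst.
have ms : measurable (snd @^-1` ([set zhat i] : set T) : set (T * T)).
  by rewrite -[X in measurable X]setTI; exact: measurable_snd.
rewrite [RHS](measureDI gamma ms mf).
rewrite [X in (X + _)%E](_ : _ = 0%E); last first.
  apply: (subset_measure0 _ _ _ gamma_fstC).
  - exact: measurableD.
  - rewrite -[X in measurable X]setTI.
    by apply: measurable_fst => //; exact: measurableC.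
  - by move=> u [_ /= nZ].
by rewrite add0e; congr (gamma _); apply/seteqP; split=> u [].
Qed.

Let A x k : set T := first_argmax (fun k => ellk k x) k.

Let mA x k : measurable (A x k).
Proof.
by apply: measurable_first_argmax => k'; exact: concave_continuous.
Qed.

Let E x (ik : 'I_N * 'I_K) : set (T * T) :=
  ((Z : set T) `&` A x ik.2) `*` [set zhat ik.1].

Let mE x ik : measurable (E x ik).
Proof. by apply: measurableX => //; exact: measurableI. Qed.

Let ED x ik : E x ik `<=` D.
Proof. by move=> u [[Zu _] /= ue]; split=> //; exists ik.1. Qed.

Let indic_cell x i k (u : T * T) : Z u.1 ->
  \1_(E x (i, k)) u = \1_(A x k) u.1 * \1_[set zhat i] u.2 :> R.
Proof.
move=> Zu; rewrite !indicE -natrM mulnb; congr (_%:R).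
apply: congr1; apply/idP/andP => [/set_mem[[_ Au] zu]|[/set_mem Au /set_mem zu]].
  by split; exact/mem_set.
exact/mem_set.
Qed.

Let sum_indic_cell x i (u : T * T) : Z u.1 ->
  \sum_k \1_(E x (i, k)) u = \1_[set zhat i] u.2 :> R.
Proof.
move=> Zu; under eq_bigr do rewrite indic_cell//.
by rewrite -big_distrl/= sum_indic_first_argmax// ?mul1r.
Qed.

Let pou x u : D u -> \sum_ik (mult ik.1)^-1 * \1_(E x ik) u = 1.
Proof.
move=> [Zu ru].
rewrite -(pair_bigA _ (fun i k => (mult i)^-1 * \1_(E x (i, k)) u))/=.
under eq_bigr do rewrite -big_distrr/= sum_indic_cell//.
exact: sum_mult.
Qed.

Let measurable_cost : measurable_fun D (fun u => c u.1 u.2).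
Proof.
pose h (u : T * T) := \sum_i (mult i)^-1 * (\1_[set zhat i] u.2 * c u.1 (zhat i)).
apply: (@eq_measurable_fun _ _ _ _ _ h).
  move=> u /set_mem[Zu ru]; rewrite -[RHS]mul1r -(sum_mult ru) big_distrl.
  apply: eq_bigr => i _ /=; rewrite -mulrA indicE.
  by case: (boolP (u.2 \in _)) => [/set_mem ->|_]; rewrite ?mul0r ?mulr0.
apply: measurable_sum => i; apply: measurable_funM; first exact: measurable_cst.
apply: measurable_funM.
  have mi : measurable_fun [set: T] (\1_[set zhat i] : T -> R).
    exact: measurable_indic.
  have := measurableT_comp mi (measurable_snd : measurable_fun [set: T * T] snd).
  by move=> H; apply: measurable_funTS; exact: H.
have mcZ : measurable_fun (Z : set T) (fun z : T => c z (zhat i)).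
  by apply: lsc_measurable_fun; exact: c_lsc.
have DZ : fst @` D `<=` Z by move=> _ [u [Zu _] <-].
have mfD : measurable_fun D (fst : T * T -> T).
  by apply: measurable_funTS; exact: measurable_fst.
exact: (measurable_comp mZ DZ mcZ mfD).
Qed.

Let cost_integral_le rho :
  (\int[gamma]_(u in (Z `*` Z : set (T * T))) (c u.1 u.2)%:E <= rho%:E)%E ->
  (\int[gamma]_(u in D) (c u.1 u.2)%:E <= rho%:E)%E.
Proof.
apply: le_trans; apply: ge0_subset_integral_any.
  by move=> u [Zu [i _ iu]]; split=> //=; rewrite -iu.
by move=> u [Z1 Z2]; rewrite lee_fin c0.
Qed.

Let integrable_cost rho :
  (\int[gamma]_(u in D) (c u.1 u.2)%:E <= rho%:E)%E ->
  gamma.-integrable D (EFin \o (fun u => c u.1 u.2)).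
Proof.
move=> le_rho; apply/integrableP; split; first exact/measurable_EFinP.
apply: le_lt_trans (ltry rho); apply: le_trans le_rho.
rewrite le_eqVlt; apply/orP; left; apply/eqP; apply: eq_integral => u.
by move=> /set_mem[Zu [i _ iu]] /=; rewrite ger0_norm// c0// -iu.
Qed.

Lemma integrable_coord rho i k x j :
  (\int[gamma]_(u in D) (c u.1 u.2)%:E <= rho%:E)%E ->
  gamma.-integrable (E x (i, k)) (fun u => ((u.1 : 'rV[R]_m) ord0 j)%:E).
Proof.
move=> /integrable_cost ic; have [M M0 HM] := c_coercive i.
have icE := integrableS mD (mE x (i, k)) (@ED x (i, k)) ic.
have i1 := finite_measure_integrable_cst gamma 1 (mE x (i, k)).
have ig := integrableZl (mE x (i, k)) M (integrableD (mE x (i, k)) i1 icE).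
apply: (le_integrable (mE x (i, k)) _ _ ig).
  have mj : measurable_fun [set: T] (fun z : T => (z : 'rV[R]_m) ord0 j).
    by apply: continuous_measurable_rV; exact: coord_continuous.
  have := measurableT_comp mj (measurable_fst : measurable_fun [set: T * T] fst).
  by move=> H; apply/measurable_EFinP; apply: measurable_funTS; exact: H.
move=> u [[Zu _] /= ->].
rewrite [leRHS](_ : _ = `|M * (1 + c u.1 (zhat i))|%:E)// lee_fin.
apply: le_trans (coord_le_norm _ _) _.
exact: le_trans (HM _ Zu) (ler_norm _).
Qed.

Let integrable_loss_fst rho x :
  (\int[gamma]_(u in (Z `*` Z : set (T * T))) (c u.1 u.2)%:E <= rho%:E)%E ->
  (exists M, forall z i, Z z -> ell x z <= M + c z (zhat i)) ->
  (\int[gamma]_(u in D) ((ell x)^\+ u.1)%:E < +oo)%E.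
Proof.
move=> /cost_integral_le /integrable_cost ic [M HM].
have iM := integrableD mD (finite_measure_integrable_cst gamma `|M| mD) ic.
have /integrableP[_] := iM; apply: le_lt_trans.
apply: ge0_le_integral; first exact: mD.
- by move=> u _; rewrite lee_fin funrpos_ge0.
- have mx := measurable_funrpos (@measurable_loss x).
  have := measurableT_comp mx (measurable_fst : measurable_fun [set: T * T] fst).
  by move=> H; apply/measurable_EFinP; apply: measurable_funTS; exact: H.
- by apply: measurableT_comp => //; case/integrableP : iM.
- move=> u [Zu [i _ iu]] /=; rewrite lee_fin -iu.
  have cu : 0 <= c u.1 (zhat i) by exact: c0.
  rewrite ger0_norm ?addr_ge0// /funrpos ge_max addr_ge0// andbT.
  by apply: le_trans (HM _ i Zu) _; rewrite lerD2r ler_norm.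
Qed.

Lemma integrable_loss_pos rho x :
  (\int[gamma]_(u in (Z `*` Z : set (T * T))) (c u.1 u.2)%:E <= rho%:E)%E ->
  (exists M, forall z i, Z z -> ell x z <= M + c z (zhat i)) ->
  Q.-integrable [set: T] (EFin \o (ell x)^\+).
Proof.
move=> le_rho bd; have mx := measurable_funrpos (@measurable_loss x).
apply/integrableP; split; first exact/measurable_EFinP.
have := integrable_loss_fst le_rho bd.
rewrite (_ : (fun z : T => _) = (fun z : T => ((ell x)^\+ z)%:E)); last first.
  by apply/funext => z /=; rewrite ger0_norm.
rewrite (integral_marginal (gamma := gamma)); last 2 first.
- by move=> A' mA'; case: (Qgamma mA').
- exact/measurable_EFinP.
rewrite [X in _ -> (X < _)%E](ge0_negligible_integral (measurableC mD))//.
  by rewrite setTD setCK.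
  have := measurableT_comp mx (measurable_fst : measurable_fun [set: T * T] fst).
  by move=> H; apply/measurable_EFinP; exact: H.
by move=> u _; rewrite lee_fin funrpos_ge0.
Qed.

Lemma compression rho x :
  (\int[gamma]_(u in (Z `*` Z : set (T * T))) (c u.1 u.2)%:E <= rho%:E)%E ->
  Q.-integrable [set: T] (EFin \o ell x) ->
  exists p z, feasible Z c zhat rho p z /\
    \int[Q]_z ell x z <= payoff ellk p z x.
Proof.
move=> /cost_integral_le le_rho ix; have ic := integrable_cost le_rho.
have mx : measurable_fun [set: T] (EFin \o (ell x : T -> R)).
  by apply/measurable_EFinP; exact: measurable_loss.
have iux : gamma.-integrable [set: T * T] (EFin \o (fun u : T * T => ell x u.1)).
  apply/integrableP; split.
    exact: (measurableT_comp mx (measurable_fst : measurable_fun [set: T * T] fst)).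
  case/integrableP : ix => _; rewrite (integral_marginal (gamma := gamma)).
  - by [].
  - by move=> A' mA'; case: (Qgamma mA').
  - exact: measurableT_comp.
have iuxD := integrableS measurableT mD (@subsetT _ _) iux.
have QD : \int[Q]_z ell x z = \int[gamma]_(u in D) ell x u.1.
  rewrite /Rintegral; congr fine.
  rewrite (integral_marginal (gamma := gamma) _ mx); last first.
    by move=> A' mA'; case: (Qgamma mA').
  rewrite (negligible_integral (measurableC mD) _ iux)//.
  by rewrite setTD setCK.
have /choice[z hz] (ik : 'I_N * 'I_K) : exists z,
    [/\ Z z, fine (gamma (E x ik)) * c z (zhat ik.1) <=
        \int[gamma]_(u in E x ik) c u.1 u.2 &
      \int[gamma]_(u in E x ik) ell x u.1 <=
        fine (gamma (E x ik)) * ellk ik.2 x z].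
  case: ik => i k /=.
  have ceq : {in E x (i, k), (fun u => c u.1 (zhat i)) =1 (fun u => c u.1 u.2)}.
    by move=> u /set_mem[_ /= ->].
  have leq : {in E x (i, k), (fun u => ellk k x u.1) =1 (fun u => ell x u.1)}.
    move=> u /set_mem[[_ [Mk _]] _]; have [[k' _ k'x] ub] := ell_max x u.1.
    apply/eqP; rewrite eq_le ub/=; last by exists k.
    by rewrite -k'x; exact: Mk.
  have icE := integrableS mD (mE x (i, k)) (@ED x (i, k)) ic.
  have ixE := integrableS mD (mE x (i, k)) (@ED x (i, k)) iuxD.
  have [||||||z Zz [cz lz]] := @conditional_mean R m Z (c ^~ (zhat i)) (ellk k x)
    Zclosed Zconv (c_convex i) (@c_lsc i) (ellk_concave k x) _ _ gamma
    (E x (i, k)) fst.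
  - by exists (zhat i).
  - exact: mE.
  - by move=> u [[]].
  - by move=> j; exact: integrable_coord le_rho.
  - by apply: eq_integrable icE => // u uE /=; rewrite ceq.
  - by apply: eq_integrable ixE => // u uE /=; rewrite leq.
  exists z; split => //=.
    by rewrite -(eq_Rintegral _ ceq).
  by rewrite -(eq_Rintegral _ leq).
pose p i k := (mult i)^-1 * fine (gamma (E x (i, k))).
exists p, (fun i k => z (i, k)); split; first split.
- by move=> i k; rewrite mulr_ge0// ?fine_ge0// invr_ge0 ltW.
- move=> i; rewrite -big_distrr/=.
  have -> : \sum_k fine (gamma (E x (i, k))) = N%:R^-1 * mult i.
    have mS : measurable ((Z : set T) `*` ([set zhat i] : set T)).
      exact: measurableX.
    rewrite (_ : N%:R^-1 * mult i = \int[gamma]_(_ in (Z : set T) `*`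
        ([set zhat i] : set T)) 1); last first.
      by rewrite Rintegral_cst// mul1r; exact/esym/(congr1 fine (gamma_slice i)).
    rewrite (Rintegral_partition_of_unity (a := fun=> 1)
      (E := fun k => E x (i, k)) mS).
    + by apply: eq_bigr => k _; rewrite Rintegral_cst// !mul1r.
    + by move=> k; exact: mE.
    + by move=> k u [[Zu _] zu].
    + move=> u [Zu zu]; under eq_bigr do rewrite mul1r.
      by rewrite sum_indic_cell// indicE mem_set.
    + exact: finite_measure_integrable_cst.
  by rewrite mulrCA mulVf ?mulr1// gt_eqF.
- by move=> i k; case: (hz (i, k)).
- have := Rintegral_partition_of_unity mD (mE x) (@ED x) (@pou x) ic.
  rewrite -lee_fin => e; apply: le_trans le_rho.
  rewrite -[leRHS]fineK; last exact: integrable_fin_num.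
  rewrite lee_fin [leRHS]e pair_bigA; apply: ler_sum => -[i k] _ /=.
  rewrite /p -mulrA ler_wpM2l ?invr_ge0 ?(ltW (mult_gt0 i))//.
  by case: (hz (i, k)).
rewrite QD (Rintegral_partition_of_unity mD (mE x) (@ED x) (@pou x) iuxD).
rewrite /payoff pair_bigA; apply: ler_sum => -[i k] _ /=.
rewrite /p -mulrA ler_wpM2l ?invr_ge0 ?(ltW (mult_gt0 i))//.
by case: (hz (i, k)).
Qed.

End fixed_coupling.
End compression.

(** * From discrete adversaries to distributions *)

Section discrete_measure.
Context d (T : measurableType d) (R : realType) (I : finType).
Variables (w : I -> {nonneg R}) (pt : I -> T).

Definition discrete_measure (A : set T) : \bar R :=
  (\sum_i (w i)%:num%:E * dirac (pt i) A)%E.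

Let f k : {measure set T -> \bar R} :=
  if insub k is Some i then mscale (w (enum_val (i : 'I_#|I|)))
                                   (dirac (pt (enum_val i)))
  else mzero.

Let discrete_measureE : discrete_measure = msum f #|I|.
Proof.
apply/funext => A; rewrite /discrete_measure /msum/= big_enum_val/=.
by apply: eq_bigr => i _; rewrite /f valK.
Qed.

Let discrete0 : discrete_measure set0 = 0%E.
Proof. by rewrite discrete_measureE measure0. Qed.

Let discrete_ge0 A : (0 <= discrete_measure A)%E.
Proof. by rewrite discrete_measureE measure_ge0. Qed.

Let discrete_sigma_additive : semi_sigma_additive discrete_measure.
Proof. by rewrite discrete_measureE; exact: measure_semi_sigma_additive. Qed.

HB.instance Definition _ := isMeasure.Build _ _ _ discrete_measure
  discrete0 discrete_ge0 discrete_sigma_additive.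

Let ge0_integral_discrete (g : T -> \bar R) :
  measurable_fun [set: T] g -> (forall x, 0 <= g x)%E ->
  (\int[discrete_measure]_x g x = \sum_i (w i)%:num%:E * g (pt i))%E.
Proof.
move=> mg g0.
rewrite (_ : integral _ _ _ = (\int[msum f #|I|]_x g x)%E); last first.
  by rewrite -discrete_measureE.
rewrite ge0_integral_measure_sum// [RHS]big_enum_val/=.
apply: eq_bigr => i _; rewrite /f valK ge0_integral_mscale// integral_dirac//.
by rewrite diracE mem_set// mul1e.
Qed.

Lemma integral_discrete (g : T -> R) : measurable_fun [set: T] g ->
  (\int[discrete_measure]_x (g x)%:E = (\sum_i (w i)%:num * g (pt i))%:E)%E.
Proof.
move=> mg; have mEg : measurable_fun [set: T] (EFin \o g) by exact/measurable_EFinP.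
rewrite integralE !ge0_integral_discrete//; last 2 first.
- exact: measurable_funeneg.
- exact: measurable_funepos.
rewrite funerpos funerneg/=.
under eq_bigr do rewrite -EFinM.
under [X in (_ - X)%E]eq_bigr do rewrite -EFinM.
rewrite !sumEFin -EFinB -sumrB; congr (_%:E).
apply: eq_bigr => i _; rewrite -mulrBr; congr (_ * _).
exact: (congr1 (fun h => h (pt i)) (funrposBneg g)).
Qed.

Import HBNNSimple.

Lemma integral_discrete_le (D : set T) (g : T -> R) :
  (forall x, D x -> 0 <= g x) -> (forall i, D (pt i)) ->
  (\int[discrete_measure]_(x in D) (g x)%:E <=
    (\sum_i (w i)%:num * g (pt i))%:E)%E.
Proof.
move=> g0 Dpt; rewrite ge0_integralE//; apply: ge_ereal_sup => _ [h hg <-].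
rewrite -integralT_nnsfun integral_discrete; last exact: measurable_funPT.
rewrite lee_fin ler_sum// => i _; rewrite ler_wpM2l//.
by have := hg (pt i); rewrite patchE mem_set// lee_fin.
Qed.

Hypothesis w1 : \sum_i (w i)%:num = 1.

Let discrete_setT : discrete_measure [set: T] = 1%E.
Proof.
rewrite /discrete_measure; under eq_bigr do rewrite diracT mule1.
by rewrite sumEFin w1.
Qed.

HB.instance Definition _ :=
  Measure_isProbability.Build _ _ _ discrete_measure discrete_setT.

Definition discrete_probability : probability T R := discrete_measure.

End discrete_measure.

Section discrete_adversary.
Context {R : realType} {n m N K : nat}.
Local Notation T := (borel_rV R m).
Variables (Z : set 'rV[R]_m) (c : 'rV[R]_m -> 'rV[R]_m -> R).
Variables (zhat : 'I_N -> 'rV[R]_m) (ell : 'rV[R]_n -> 'rV[R]_m -> R).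
Hypothesis N0 : (0 < N)%N.
Hypothesis zhatZ : forall i, Z (zhat i).
Hypothesis c0 : forall z zh, Z z -> Z zh -> 0 <= c z zh.
Hypothesis ell_measurable :
  forall x, measurable_fun [set: T] (ell x : T -> R).

Lemma discrete_adversary rho p z : @feasible R m N K Z c zhat rho p z ->
  exists2 Q : probability T R, ambiguity_set Z c zhat rho Q &
    forall x, risk ell Q x = (\sum_i \sum_k p i k * ell x (z i k))%:E.
Proof.
move=> [p0 pN Zz cz].
pose w (ik : 'I_N * 'I_K) : {nonneg R} := NngNum (p0 ik.1 ik.2).
have w1 : \sum_ik (w ik)%:num = 1.
  rewrite -(pair_bigA _ (fun i k => p i k))/=.
  rewrite (eq_bigr (fun=> N%:R^-1)) => [|i _]; last exact: pN.
  by rewrite sumr_const card_ord -[LHS]mulr_natl mulfV// pnatr_eq0 -lt0n.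
pose pt (ik : 'I_N * 'I_K) : T := z ik.1 ik.2.
pose pt2 (ik : 'I_N * 'I_K) : T * T := (z ik.1 ik.2, zhat ik.1).
exists (discrete_probability pt w1); last first.
  move=> x; rewrite /risk unlock integral_discrete//.
  by rewrite [in RHS]pair_bigA.
split.
  rewrite /= /discrete_measure (eq_bigr (fun ik => (w ik)%:num%:E)) => [|ik _].
    by rewrite sumEFin w1.
  by rewrite diracE mem_set ?mule1//; exact: Zz.
apply: ge_ereal_inf; exists (\int[discrete_probability pt2 w1]_(u in
    (Z `*` Z : set (T * T))) (c u.1 u.2)%:E)%E.
  exists (discrete_probability pt2 w1) => // A mA; split; first by [].
  rewrite /= /pushforward /discrete_measure /empirical ge0_sume_distrr//.
  rewrite -(pair_bigA _ (fun i k => (p i k)%:E * dirac (zhat i : T) A)%E)/=.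
  apply: eq_bigr => i _; rewrite -ge0_sume_distrl; last first.
    by move=> k _; rewrite lee_fin.
  by rewrite sumEFin pN.
apply: le_trans (integral_discrete_le (g := fun u : T * T => c u.1 u.2) _ _ _) _.
- by move=> u [Zu1 Zu2]; exact: c0.
- by move=> ik; split; [exact: Zz|exact: zhatZ].
- by rewrite lee_fin; apply: le_trans cz; rewrite [leRHS]pair_bigA.
Qed.

End discrete_adversary.

(** * Growth conditions *)

Section growth.
Context {R : realType}.

Lemma le_add_powR (p t : R) : 1 <= p -> 0 <= t -> t <= 1 + t `^ p.
Proof.
move=> p1 t0; have [t1|/ltW t1] := leP t 1.
  by apply: le_trans t1 _; rewrite lerDl powR_ge0.
apply: ler_wpDl => //; rewrite -[leLHS]powRr1//.
exact: ler_powR.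
Qed.

Lemma le_eps_powR (p e : R) : 1 < p -> 0 < e ->
  exists M, forall t, 0 <= t -> t <= M + e * t `^ p.
Proof.
move=> p1 e0; pose B := e^-1 `^ (p - 1)^-1.
have pp : 0 < p - 1 by rewrite subr_gt0.
exists B => t t0; have [tB|/ltW Bt] := leP t B.
  by apply: ler_wpDr => //; rewrite mulr_ge0 ?powR_ge0// ltW.
apply: ler_wpDl; first exact: powR_ge0.
have -> : t `^ p = t * t `^ (p - 1).
  rewrite -[X in X * _]powRr1// -powRD ?subrKC//.
  by rewrite gt_eqF// (lt_trans _ p1).
rewrite mulrCA ler_peMr//.
have : B `^ (p - 1) <= t `^ (p - 1).
  by apply: ge0_ler_powR; rewrite ?nnegrE ?powR_ge0// ltW.
rewrite /B -powRrM mulVf ?gt_eqF// powRr1 ?invr_ge0 ?(ltW e0)//.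
by move=> /(ler_wpM2l (ltW e0)); rewrite divff ?gt_eqF.
Qed.

Lemma powR_le_eps (r e : R) : 0 <= r < 1 -> 0 < e ->
  exists M, forall t, 0 <= t -> t `^ r <= M + e * t.
Proof.
move=> /andP[r0 r1] e0; have [->|rn0] := eqVneq r 0.
  by exists 1 => t t0; rewrite powRr0 lerDl mulr_ge0// ltW.
have rgt : 0 < r by rewrite lt_def rn0.
have [|M HM] := @le_eps_powR r^-1 e _ e0; first by rewrite invf_gt1.
exists M => t t0; have := HM (t `^ r) (powR_ge0 _ _).
by rewrite -powRrM mulfV// powRr1.
Qed.

Section norms.
Context {m : nat} (nrm : 'rV[R]_m -> R).
Hypothesis hnrm : is_norm nrm.

Lemma is_norm_ge0 z : 0 <= nrm z.
Proof.
case: hnrm => _ hZ hD.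
have n0 : nrm 0 = 0 by have := hZ 0 0; rewrite scale0r normr0 mul0r.
have := hD z (- z); rewrite subrr n0 -scaleN1r hZ normrN normr1 mul1r.
lra.
Qed.

Lemma is_norm_lower_bound : exists2 k, 0 < k & forall z, k * `|z| <= nrm z.
Proof.
case: (hnrm) => h0 hZ hD.
have cvx : convex_function [set: 'rV[R]_m] nrm.
  apply/convex_functionP => x y a b _ _ a0 b0 _.
  by apply: le_trans (hD _ _) _; rewrite !hZ !ger0_norm.
have cn := convex_continuous cvx.
pose S := [set z : 'rV[R]_m | `|z| = 1].
have [S0|/set0P S0] := eqVneq S set0.
  exists 1 => // z; have [->|z0] := eqVneq z 0.
    by rewrite normr0 mulr0 is_norm_ge0.
  have : S (`|z|^-1 *: z) by rewrite /S /= normrZ normfV normr_id mulVf ?normr_eq0.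
  by rewrite S0.
have cS : compact S.
  apply: bounded_closed_compact.
    by exists 1; split; [exact: num_real|move=> M M1 z /= ->; exact: ltW].
  rewrite (_ : S = [set z : 'rV[R]_m | `|z| <= 1] `&` [set z | - `|z| <= - 1]).
    apply: closedI; apply: closed_sublevel; first exact: norm_continuous.
    by move=> z; apply: continuousN; exact: norm_continuous.
  apply/seteqP; split=> z /=; first by move=> ->.
  by rewrite lerN2 => -[h1 h2]; apply/eqP; rewrite eq_le h1.
have [c /set_mem cS1 cmin] := EVT_min_rV S0 cS (continuous_subspaceT cn).
exists (nrm c).
  rewrite lt_def is_norm_ge0 andbT; apply/eqP => /h0 c00.
  by move: cS1; rewrite /S /= c00 normr0 => /esym/eqP; rewrite oner_eq0.
move=> z; have [->|z0] := eqVneq z 0; first by rewrite normr0 mulr0 is_norm_ge0.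
have nz0 : `|z| != 0 by rewrite normr_eq0.
have : nrm c <= nrm (`|z|^-1 *: z).
  by apply: cmin; apply/mem_set; rewrite /S /= normrZ normfV normr_id mulVf.
by rewrite hZ normfV normr_id -ler_pdivlMr ?normr_gt0// mulrC.
Qed.

Variables (Z : set 'rV[R]_m) (c : 'rV[R]_m -> 'rV[R]_m -> R) (p : R).
Hypothesis p1 : 1 <= p.
Hypothesis c_nrm : forall z zh, Z z -> Z zh -> nrm (z - zh) `^ p <= c z zh.

Lemma cost_coercive zh : Z zh ->
  exists2 M : R, 0 <= M & forall z, Z z -> `|z| <= M * (1 + c z zh).
Proof.
move=> Zh; have [k k0 hk] := is_norm_lower_bound; case: hnrm => _ _ hD.
exists (k^-1 * (1 + nrm zh)).
  by rewrite mulr_ge0 ?invr_ge0 ?(ltW k0)// addr_ge0// is_norm_ge0.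
move=> z Zz; rewrite -mulrA [leRHS]mulrC ler_pdivlMr// mulrC.
apply: le_trans (hk z) _.
have := hD (z - zh) zh; rewrite subrK => /le_trans; apply.
have := le_add_powR p1 (is_norm_ge0 (z - zh)).
have := c_nrm Zz Zh; have := is_norm_ge0 zh.
have := powR_ge0 (nrm (z - zh)) p; nra.
Qed.

Lemma concave_growth (f : 'rV[R]_m -> R) zh (e : R) : 1 < p -> Z zh ->
  convex_function [set: 'rV[R]_m] (fun z => - f z) -> 0 < e ->
  exists M, forall z, Z z -> f z <= M + e * c z zh.
Proof.
move=> p1' Zh cf e0; have [k k0 hk] := is_norm_lower_bound.
case: hnrm => _ _ hD.
have [A A0 HA] := convex_linear_lower_bound cf.
have d0 : 0 < e * k / (A + 1) by rewrite divr_gt0 ?mulr_gt0// ltr_wpDl.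
have [M HM] := le_eps_powR p1' d0.
exists (A + A / k * (M + nrm zh)) => z Zz.
have := HA z; rewrite opprK => /le_trans; apply.
have zle : `|z| <= (nrm (z - zh) + nrm zh) / k.
  rewrite ler_pdivlMr// mulrC; apply: le_trans (hk z) _.
  by have := hD (z - zh) zh; rewrite subrK.
have tle : nrm (z - zh) <= M + e * k / (A + 1) * c z zh.
  apply: le_trans (HM _ (is_norm_ge0 _)) _.
  by rewrite lerD2l ler_wpM2l ?(ltW d0)// c_nrm.
have c0 : 0 <= c z zh by apply: le_trans (c_nrm Zz Zh); exact: powR_ge0.
have Ak : 0 <= A / k by rewrite divr_ge0// ltW.
have Az : A * `|z| <= A / k * (nrm (z - zh) + nrm zh).
  by apply: le_trans (ler_wpM2l A0 zle) _; rewrite mulrCA mulrC.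
have At : A / k * nrm (z - zh) <= A / k * M + e * c z zh.
  apply: le_trans (ler_wpM2l Ak tle) _; rewrite mulrDr lerD2l.
  have -> : A / k * (e * k / (A + 1) * c z zh) = A / (A + 1) * (e * c z zh).
    by field; rewrite !gt_eqF// ltr_wpDl.
  rewrite ler_piMl ?mulr_ge0 ?(ltW e0)//.
  by rewrite ler_pdivrMr ?mul1r ?lerDl// ltr_wpDl.
lra.
Qed.

Lemma sublinear_growth (f : 'rV[R]_m -> R) zh z0 (g r e : R) :
  p = 1 -> Z zh -> 0 < g -> 0 <= r < 1 -> 0 < e ->
  (forall z, Z z -> f z <= g * (1 + nrm (z - z0) `^ r)) ->
  exists M, forall z, Z z -> f z <= M + e * c z zh.
Proof.
move=> p_eq1 Zh g0 r01 e0 hf; case: hnrm => _ _ hD.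
have [M HM] := powR_le_eps r01 (divr_gt0 e0 g0).
exists (g + g * M + e * nrm (zh - z0)) => z Zz.
apply: le_trans (hf z Zz) _.
have h1 := HM _ (is_norm_ge0 (z - z0)).
have h2 : nrm (z - z0) <= nrm (z - zh) + nrm (zh - z0).
  by have := hD (z - zh) (zh - z0); rewrite addrA subrK.
have h3 : nrm (z - zh) <= c z zh.
  by have := c_nrm Zz Zh; rewrite p_eq1 powRr1// is_norm_ge0.
have h4 : g * nrm (z - z0) `^ r <= g * M + e * nrm (z - z0).
  apply: le_trans (ler_wpM2l (ltW g0) h1) _.
  by rewrite mulrDr lerD2l mulrA mulrCA divff ?mulr1// gt_eqF.
have := ler_wpM2l (ltW e0) (le_trans h2 (lerD h3 (lexx _))).
lra.
Qed.

End norms.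

End growth.

(** * Saddle point *)

Section integral_convexity.
Context d (T : measurableType d) (R : realType) (mu : {measure set T -> \bar R}).
Implicit Types g : T -> R.

Lemma integrable_or_ninfty g : measurable_fun [set: T] g ->
  mu.-integrable [set: T] (EFin \o g^\+) ->
  mu.-integrable [set: T] (EFin \o g) \/ (\int[mu]_x (g x)%:E = -oo)%E.
Proof.
move=> mg ip; have [in_|] := boolP (mu.-integrable [set: T] (EFin \o g^\-)).
  left; apply: eq_integrable (integrableB measurableT ip in_) => // x _ /=.
  rewrite -EFinB; congr (_%:E).
  exact: (congr1 (fun h => h x) (funrposBneg g)).
move=> nin; right; rewrite integralE funerpos funerneg /=.
have -> : (\int[mu]_x (g^\- x)%:E = +oo)%E.
  apply/eqP; rewrite -leye_eq leNgt; apply: contra nin => lt_oo.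
  apply/integrableP; split.
    by apply/measurable_EFinP; exact: measurable_funrneg.
  apply: le_lt_trans lt_oo; rewrite le_eqVlt; apply/orP; left; apply/eqP.
  by apply: eq_integral => x _ /=; rewrite ger0_norm.
by rewrite addeNy.
Qed.

Lemma integral_convex_le g g1 g2 (a b u v : R) :
  measurable_fun [set: T] g -> measurable_fun [set: T] g1 ->
  measurable_fun [set: T] g2 -> mu.-integrable [set: T] (EFin \o g^\+) ->
  mu.-integrable [set: T] (EFin \o g1^\+) ->
  mu.-integrable [set: T] (EFin \o g2^\+) ->
  0 < a -> 0 < b -> (forall x, g x <= a * g1 x + b * g2 x) ->
  (\int[mu]_x (g1 x)%:E <= u%:E)%E -> (\int[mu]_x (g2 x)%:E <= v%:E)%E ->
  (\int[mu]_x (g x)%:E <= (a * u + b * v)%:E)%E.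
Proof.
move=> mg mg1 mg2 ip ip1 ip2 a0 b0 gle uge vge.
have [ig|->] := integrable_or_ninfty mg ip; last exact: leNye.
have i1p := integrableZl measurableT a ip1.
have i2p := integrableZl measurableT b ip2.
have ih := integrableD measurableT (integrable_abse ig)
  (integrableD measurableT i1p i2p).
have pos (h : T -> R) x : 0 <= h^\+ x by exact: funrpos_ge0.
have le_pos (h : T -> R) x : h x <= h^\+ x by rewrite /funrpos le_max lexx.
have integrable_dominated (k : R) (h : T -> R) : 0 < k ->
    measurable_fun [set: T] h ->
    (forall x, k * `|h x| <= `|g x| + (a * g1^\+ x + b * g2^\+ x)) ->
    mu.-integrable [set: T] (EFin \o h).
  move=> k0 mh hle.
  apply: (le_integrable measurableT _ _ (integrableZl measurableT k^-1 ih)).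
    exact/measurable_EFinP.
  move=> x _; rewrite [leRHS](_ : _ =
    `|k^-1 * (`|g x| + (a * g1^\+%R x + b * g2^\+%R x))|%:E)// lee_fin.
  rewrite (le_trans _ (ler_norm _))// mulrC ler_pdivlMr// mulrC.
  exact: hle.
have i1 : mu.-integrable [set: T] (EFin \o g1).
  apply: (@integrable_dominated a) => // x.
  have := gle x; have := pos g1 x; have := pos g2 x.
  have := ler_wpM2l (ltW b0) (le_pos g2 x).
  have := ler_norm (- g x); rewrite normrN; have := normr_ge0 (g x).
  have := le_pos g1 x; have := ltW a0; have := ltW b0.
  by case: (ler0P (g1 x)) => *; nra.
have i2 : mu.-integrable [set: T] (EFin \o g2).
  apply: (@integrable_dominated b) => // x.
  have := gle x; have := pos g1 x; have := pos g2 x.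
  have := ler_wpM2l (ltW a0) (le_pos g1 x).
  have := ler_norm (- g x); rewrite normrN; have := normr_ge0 (g x).
  have := le_pos g2 x; have := ltW a0; have := ltW b0.
  by case: (ler0P (g2 x)) => *; nra.
have i12 := integrableD measurableT (integrableZl measurableT a i1)
  (integrableZl measurableT b i2).
apply: (@le_trans _ _ (\int[mu]_x (a%:E * (g1 x)%:E + b%:E * (g2 x)%:E))%E).
  by apply: le_integral => // x _; rewrite -!EFinM -EFinD lee_fin.
rewrite integralD//; last 2 first.
- exact: integrableZl i1.
- exact: integrableZl i2.
rewrite !integralZl//.
by rewrite EFinD !EFinM leeD// lee_wpmul2l// lee_fin ltW.
Qed.

End integral_convexity.

Section saddle_values.
Context {R : realType} {n m : nat}.
Local Open Scope ereal_scope.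

Lemma saddle_point_values (X : set 'rV[R]_n) (P : set (probability (borel_rV R m) R))
    (ell : 'rV[R]_n -> 'rV[R]_m -> R) xs Qs (v : R) :
  saddle_point X P ell xs Qs -> risk ell Qs xs = v%:E ->
  [/\ primal_value X P ell = v%:E, dual_value X P ell = v%:E,
      is_minimum [set ereal_sup [set risk ell Q x | Q in P] | x in X] v%:E,
      is_maximum [set risk ell Q xs | Q in P] v%:E &
      is_maximum [set ereal_inf [set risk ell Q x | x in X] | Q in P] v%:E /\
      is_minimum [set risk ell Qs x | x in X] v%:E].
Proof.
move=> [Xxs PQs sad] rv.
have maxQ : is_maximum [set risk ell Q xs | Q in P] v%:E.
  split; first by exists Qs.
  by move=> _ [Q PQ <-]; rewrite -rv; have [] := sad xs Q Xxs PQ.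
have minx : is_minimum [set risk ell Qs x | x in X] v%:E.
  split; first by exists xs.
  by move=> _ [x Xx <-]; rewrite -rv; have [] := sad x Qs Xx PQs.
have supE : ereal_sup [set risk ell Q xs | Q in P] = v%:E.
  apply/eqP; rewrite eq_le ge_ereal_sup; last by case: maxQ.
  by apply: ereal_sup_ubound; case: maxQ.
have infE : ereal_inf [set risk ell Qs x | x in X] = v%:E.
  apply/eqP; rewrite eq_le le_ereal_inf_tmp; last by case: minx.
  by rewrite andbT; apply: ereal_inf_lbound; case: minx.
have minP : is_minimum [set ereal_sup [set risk ell Q x | Q in P] | x in X] v%:E.
  split; first by exists xs.
  move=> _ [x Xx <-]; apply: (@le_trans _ _ (risk ell Qs x)).
    by case: minx => _; apply; exists x.
  by apply: ereal_sup_ubound; exists Qs.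
have maxD : is_maximum [set ereal_inf [set risk ell Q x | x in X] | Q in P] v%:E.
  split; first by exists Qs.
  move=> _ [Q PQ <-]; apply: (@le_trans _ _ (risk ell Q xs)).
    by apply: ereal_inf_lbound; exists xs.
  by case: maxQ => _; apply; exists Q.
split => //.
- apply/eqP; rewrite /primal_value eq_le le_ereal_inf_tmp; last by case: minP.
  by rewrite andbT; apply: ereal_inf_lbound; case: minP.
- apply/eqP; rewrite /dual_value eq_le ge_ereal_sup; last by case: maxD.
  by apply: ereal_sup_ubound; case: maxD.
Qed.

End saddle_values.

Section regular_dro.
Context {R : realType} {n m N K : nat}.
Local Notation T := (borel_rV R m).
Variables (X : set 'rV[R]_n) (Z : set 'rV[R]_m).
Variables (c : 'rV[R]_m -> 'rV[R]_m -> R) (zhat : 'I_N -> 'rV[R]_m) (rho : R).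
Variable ellk : 'I_K -> 'rV[R]_n -> 'rV[R]_m -> R.
Variable ell : 'rV[R]_n -> 'rV[R]_m -> R.
Hypotheses (N0 : (0 < N)%N) (K0 : (0 < K)%N) (rho_gt0 : 0 < rho).
Hypothesis Xconv : convex_set X.
Hypotheses (Zclosed : closed Z) (Zconv : convex_set Z).
Hypothesis zhatZ : forall i, Z (zhat i).
Hypothesis c0 : forall z zh, Z z -> Z zh -> 0 <= c z zh.
Hypothesis c_diag : forall z, Z z -> c z z = 0.
Hypothesis c_convex : forall i, convex_function Z (c ^~ (zhat i)).
Hypothesis c_lsc : forall i z a, Z z -> a < c z (zhat i) ->
  \forall z' \near z, Z z' -> a < c z' (zhat i).
Hypothesis c_coercive : forall i,
  exists2 M : R, 0 <= M & forall z, Z z -> `|z| <= M * (1 + c z (zhat i)).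
Hypothesis ellk_convex : forall k z,
  convex_function [set: 'rV[R]_n] (fun x => ellk k x z).
Hypothesis ellk_concave : forall k x,
  convex_function [set: 'rV[R]_m] (fun z => - ellk k x z).
Hypothesis ell_max :
  forall x z, is_maximum [set ellk k x z | k in [set: 'I_K]] (ell x z).
Hypothesis ellk_growth : forall i k x, X x -> forall e : R, 0 < e ->
  exists M, forall z, Z z -> ellk k x z <= M + e * c z (zhat i).

Local Notation P := (ambiguity_set Z c zhat rho).
Local Notation G := (payoffs Z c zhat ellk rho).

Let mell x : measurable_fun [set: T] (ell x : T -> R).
Proof. exact: measurable_loss ell_max x. Qed.

Let growth_bound x : X x ->
  exists M, forall i k z, Z z -> ellk k x z <= M + c z (zhat i).
Proof.
move=> Xx.
have /choice[M HM] (ik : 'I_N * 'I_K) : exists M, forall z, Z z ->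
    ellk ik.2 x z <= M + 1 * c z (zhat ik.1) by exact: ellk_growth.
exists (\sum_ik `|M ik|) => i k z Zz.
apply: le_trans (HM (i, k) z Zz) _; rewrite mul1r lerD2r.
apply: le_trans (ler_norm _) _.
by rewrite (bigD1 (i, k))//= lerDl sumr_ge0.
Qed.

Let loss_bound x : X x ->
  exists M, forall z i, Z z -> ell x z <= M + c z (zhat i).
Proof.
move=> /growth_bound[M HM]; exists M => z i Zz.
by have [[k _ <-] _] := ell_max x z; exact: HM.
Qed.

Let payoffs_bounded x : X x -> exists B, forall g, G g -> g x <= B.
Proof.
move=> /growth_bound[M HM]; exists (\sum_(i < N) \sum_(k < K) `|M| + rho).
move=> _ [p [z [fpz ->]]]; have [p0 _ Zz cz] := fpz.
apply: le_trans (lerD (lexx _) cz); rewrite -big_split ler_sum//= => i _.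
rewrite -big_split ler_sum//= => k _.
apply: le_trans (ler_wpM2l (p0 i k) (HM i k _ (Zz i k))) _.
rewrite mulrDr lerD2r; apply: le_trans (ler_norm _) _.
by rewrite normrM ger0_norm// ler_piMl// (feasible_le1 _ _ fpz).
Qed.

Let couplings Q : P Q -> forall e, 0 < e ->
  exists2 gamma, coupling Q (empirical zhat) gamma &
    (\int[gamma]_(u in (Z `*` Z : set (T * T))) (c u.1 u.2)%:E <=
      (rho + e)%:E)%E.
Proof.
move=> [_ otQ] e e0.
have /ereal_inf_lt[_ [gamma cg <-] lt_e] :
    (ot Z c Q (empirical zhat) < (rho + e)%:E)%E.
  by apply: le_lt_trans otQ _; rewrite lte_fin ltrDl.
by exists gamma => //; exact: ltW.
Qed.

Let integrable_pos Q x : P Q -> X x ->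
  Q.-integrable [set: T] (EFin \o (ell x)^\+).
Proof.
move=> PQ Xx; have [gamma cg le_rho] := couplings PQ ltr01.
exact: (integrable_loss_pos Zclosed zhatZ c0 c_lsc ellk_concave ell_max
  (proj1 PQ) cg le_rho (loss_bound Xx)).
Qed.

Let risk_le Q x v : P Q -> X x -> (forall g, G g -> g x <= v) ->
  (risk ell Q x <= v%:E)%E.
Proof.
move=> PQ Xx Gv; rewrite /risk unlock.
have [ix|->] := integrable_or_ninfty (mell x) (integrable_pos PQ Xx); last first.
  exact: leNye.
have /choice[p /choice[z fq]] (j : nat) : exists p, exists z,
    feasible Z c zhat (rho + j.+1%:R^-1) p z /\
    \int[Q]_z ell x z <= payoff ellk p z x.
  have [|gamma cg le_rho] := couplings PQ (e := j.+1%:R^-1); first by [].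
  exact: (compression K0 Zclosed Zconv zhatZ c0 c_convex c_lsc c_coercive
    ellk_concave ell_max (proj1 PQ) cg le_rho ix).
have [|p0 [z0 [f0 le0]]] := feasible_limit ellk_concave Zclosed zhatZ
    (fun i z Zz => c0 Zz (zhatZ i)) c_lsc c_coercive ellk_growth (p := p) (z := z)
    (rho := rho).
  by move=> j; case: (fq j).
have : \int[Q]_z ell x z <= payoff ellk p0 z0 x.
  apply: le0 => // j; have [_] := fq j; apply: le_trans.
  by rewrite gerBl.
move=> H; rewrite -[leLHS]fineK; last exact: integrable_fin_num.
rewrite lee_fin; apply: le_trans H _; apply: Gv.
by exists p0, z0.
Qed.

Let risk_convex Q x y (a b u v : R) : P Q -> X x -> X y ->
  0 <= a -> 0 <= b -> a + b = 1 ->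
  (risk ell Q x <= u%:E)%E -> (risk ell Q y <= v%:E)%E ->
  (risk ell Q (a *: x + b *: y) <= (a * u + b * v)%:E)%E.
Proof.
move=> PQ Xx Xy a0 b0 ab; rewrite /risk !unlock => xu yv.
have [a00|an0] := eqVneq a 0.
  move: ab; rewrite a00 add0r => ->.
  by rewrite scale0r add0r scale1r mul0r add0r mul1r.
have [b00|bn0] := eqVneq b 0.
  move: ab; rewrite b00 addr0 => ->.
  by rewrite scale0r addr0 scale1r mul0r addr0 mul1r.
have ag : 0 < a by rewrite lt_def an0.
have bg : 0 < b by rewrite lt_def bn0.
have Xab : X (a *: x + b *: y) by move/convex_setP : Xconv; apply.
apply: (integral_convex_le (mell _) (mell x) (mell y) (integrable_pos PQ Xab)
  (integrable_pos PQ Xx) (integrable_pos PQ Xy) ag bg _ xu yv) => z.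
have [[k _ <-] _] := ell_max (a *: x + b *: y) z.
have /convex_functionP/(_ x y a b I I a0 b0 ab) := ellk_convex k z.
move=> /le_trans; apply; rewrite lerD// ler_wpM2l//.
- by have [_] := ell_max x z; apply; exists k.
- by have [_] := ell_max y z; apply; exists k.
Qed.

Let G_neq0 : G !=set0.
Proof.
pose p (i : 'I_N) (k : 'I_K) : R := N%:R^-1 * K%:R^-1.
exists (payoff ellk p (fun i _ => zhat i)), p, (fun i _ => zhat i); split => //.
split => //.
- by move=> i k; rewrite mulr_ge0.
- move=> i; rewrite sumr_const card_ord /p -[LHS]mulr_natl mulrCA mulfV ?mulr1//.
  by rewrite pnatr_eq0 -lt0n.
- rewrite big1 ?ltW// => i _; rewrite big1// => k _.
  by rewrite c_diag ?mulr0.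
Qed.

Lemma dro_saddle_point (Q0 : probability T R) x0 :
  P Q0 -> X x0 -> inf_compact X (risk ell Q0) ->
  exists xs Qs (v : R), saddle_point X P ell xs Qs /\ risk ell Qs xs = v%:E.
Proof.
move=> PQ0 Xx0 infc.
have [B GB] := payoffs_bounded Xx0.
have cvG g : G g -> convex_function [set: 'rV[R]_n] g by exact: payoffs_convex.
have ctG g : G g -> continuous g by move=> /cvG; exact: convex_continuous.
pose A := [set x | X x /\ (risk ell Q0 x <= (B + 1)%:E)%E].
have Ax0 : A x0.
  split=> //; apply: le_trans (risk_le PQ0 Xx0 GB) _.
  by rewrite lee_fin lerDl.
have A0 : A !=set0 by exists x0.
have cA : compact A := infc (B + 1).
have cvA : convex_set A.
  apply/convex_setP => x y a b [Xx rx] [Xy ry] a0 b0 ab; split.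
    by move/convex_setP : Xconv; apply.
  apply: le_trans (risk_convex PQ0 Xx Xy a0 b0 ab rx ry) _.
  by rewrite -mulrDl ab mul1r.
have minA g : G g -> exists2 x, A x & forall y, A y -> g x <= g y.
  move=> Gg; have [x /set_mem Ax xmin] := EVT_min_rV A0 cA
    (continuous_subspaceT (ctG _ Gg)).
  by exists x => // y Ay; apply: xmin; exact/mem_set.
pose W := [set w : R | exists2 g, G g & forall x, A x -> w <= g x].
have WB : ubound W B.
  by move=> w [g Gg wg]; apply: le_trans (wg x0 Ax0) (GB g Gg).
have supW : has_sup W.
  split; last by exists B.
  have [g Gg] := G_neq0; have [x Ax xmin] := minA g Gg.
  by exists (g x), g.
pose v := sup W.
have vB : v <= B by apply: sup_le_ub => //; case: supW.
have [xs [Xxs rxs] xsv] : exists2 x, A x & forall g, G g -> g x <= v.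
  apply: minimax_compact => //.
    move=> g1 g2 a b G1 G2 a0 b0 ab.
    have [g Gg gle] := payoffs_mixable Zconv c_convex ellk_concave G1 G2 a0 b0 ab.
    by exists g => // x _; exact: gle.
  move=> g Gg; have [x Ax xmin] := minA g Gg; exists x => //.
  by apply: sup_upper_bound => //; exists g.
have /choice[p /choice[z pz]] (j : nat) : exists p, exists z,
    feasible Z c zhat rho p z /\
    forall x, A x -> v - j.+1%:R^-1 <= payoff ellk p z x.
  have [|w [_ [p [z [fpz ->]]] wle] vw] := sup_adherent (eps := j.+1%:R^-1) _ supW.
    by [].
  exists p, z; split=> // x Ax; exact: le_trans (ltW vw) (wle x Ax).
have [|p0 [z0 [f0 le0]]] := feasible_limit ellk_concave Zclosed zhatZ
    (fun i z Zz => c0 Zz (zhatZ i)) c_lsc c_coercive ellk_growth (p := p) (z := z)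
    (rho := rho).
  move=> j; have [[h1 h2 h3 h4] _] := pz j; split=> //.
  by apply: le_trans h4 _; rewrite lerDl.
have vleA x : A x -> v <= payoff ellk p0 z0 x.
  by move=> Ax; apply: le0 => [|j]; [case: Ax|case: (pz j) => _; exact].
have Gs : G (payoff ellk p0 z0) by exists p0, z0.
(* [xs] lies strictly inside the sublevel set [A], so the inequality extends
   from [A] to [X] by convexity along the segment from [xs] to [x]. *)
have vle x : X x -> v <= payoff ellk p0 z0 x.
  move=> Xx; have [D GD] := payoffs_bounded Xx.
  pose s := (2 + `|D - B|)^-1.
  have d2 : 0 < 2 + `|D - B| by rewrite ltr_wpDr.
  have s0 : 0 < s by rewrite invr_gt0.
  have s1 : 0 <= 1 - s.
    by rewrite subr_ge0 invf_le1// -[leLHS]addr0 lerD// ler1n.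
  have sDB : s * (D - B) <= 1.
    rewrite mulrC ler_pdivrMr// mul1r; apply: le_trans (ler_norm _) _.
    by rewrite lerDr.
  have rsB : (risk ell Q0 xs <= B%:E)%E.
    by apply: risk_le => // g Gg; apply: le_trans (xsv g Gg) vB.
  have As : A ((1 - s) *: xs + s *: x).
    split; first by move/convex_setP : Xconv; apply=> //; [exact: ltW|exact: subrK].
    apply: le_trans (risk_convex PQ0 Xxs Xx s1 (ltW s0) (subrK _ _) rsB
      (risk_le PQ0 Xx GD)) _.
    by rewrite lee_fin; lra.
  have /convex_functionP/(_ xs x (1 - s) s I I s1 (ltW s0) (subrK _ _)) := cvG _ Gs.
  move=> /(le_trans (vleA _ As)); have := xsv _ Gs.
  move: (payoff ellk p0 z0 xs) (payoff ellk p0 z0 x) => gs gx h1 h2.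
  have h3 := ler_wpM2l s1 h1.
  by rewrite -(ler_pM2l s0); lra.
have [Qs PQs rQs] := discrete_adversary N0 zhatZ c0 mell f0.
have rge x : X x -> (v%:E <= risk ell Qs x)%E.
  move=> Xx; rewrite rQs lee_fin; apply: le_trans (vle x Xx) _.
  apply: ler_sum => i _; apply: ler_sum => k _; apply: ler_wpM2l.
    by case: f0.
  by have [_] := ell_max x (z0 i k); apply; exists k.
have rle Q : P Q -> (risk ell Q xs <= v%:E)%E by move=> PQ; exact: risk_le.
have rs : risk ell Qs xs = v%:E by apply/eqP; rewrite eq_le rle// rge.
exists xs, Qs, v; split => //; split => // x Q Xx PQ.
by rewrite rs rle// rge.
Qed.

End regular_dro.

Lemma lsc_slice (R : realType) (m : nat) (Z : set 'rV[R]_m)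
    (c : 'rV[R]_m -> 'rV[R]_m -> R) (zh : 'rV[R]_m) :
  lower_semicontinuous (fun u : subspace (Z `*` Z) => (c u.1 u.2)%:E) ->
  Z zh -> forall z a, Z z -> a < c z zh ->
  \forall z' \near z, Z z' -> a < c z' zh.
Proof.
move=> lsc Zh z a Zz az.
have [|V + HV] := lsc (z, zh) a; first by rewrite lte_fin.
move=> nV; have {}nV : within (Z `*` Z) (nbhs (z, zh)) V.
  by rewrite nbhs_subspace_in.
have [[A B] /= [nA nB] AB] := nV.
near=> z' => Zz'; rewrite -lte_fin; apply: (HV (z', zh)).
apply: (AB (z', zh)) => //; split=> /=; last exact: nbhs_singleton.
by near: z'; exact: nA.
Unshelve. all: by end_near. Qed.

Theorem lemma1 (R : realType) (n m : nat)
    (X : set 'rV[R]_n) (Z : set 'rV[R]_m)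
    (c : 'rV[R]_m -> 'rV[R]_m -> R)
    (N : nat) (zhat : 'I_N -> 'rV[R]_m) (rho : R)
    (K : nat) (ellk : 'I_K -> 'rV[R]_n -> 'rV[R]_m -> R)
    (ell : 'rV[R]_n -> 'rV[R]_m -> R)
    (hc : transportation_cost Z c)
    (hN : (0 < N)%N)
    (hzhat : forall i, Z (zhat i))
    (hrho : 0 < rho)
    (hX0 : X !=set0) (hXconv : convex_set X)
    (hQ0 : exists (Q0 : probability (borel_rV R m) R) (x0 : 'rV[R]_n),
       [/\ ambiguity_set Z c zhat rho Q0, X x0,
           inf_compact X (risk ell Q0)
         & (-oo < risk ell Q0 x0)%E])
    (hZ0 : Z !=set0) (hZclosed : closed Z) (hZconv : convex_set Z)
    (hK : (2 <= K)%N)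
    (hell : forall x z, is_maximum [set ellk k x z | k in [set: 'I_K]] (ell x z))
    (hconvex : forall k z, convex_function [set: 'rV[R]_n] (fun x => ellk k x z))
    (hconcave : forall k x,
       convex_function [set: 'rV[R]_m] (fun z => - ellk k x z))
    (hgrowth : exists (nrm : 'rV[R]_m -> R) (p : R),
       [/\ is_norm nrm, 1 <= p,
           forall z zh, Z z -> Z zh -> nrm (z - zh) `^ p <= c z zh
         & p = 1 -> forall x, X x ->
             exists (g : R) (z0 : 'rV[R]_m) (r : R),
               [/\ 0 < g, Z z0, 0 <= r < 1
                 & forall z, Z z -> ell x z <= g * (1 + nrm (z - z0) `^ r)]]) :
  let P := ambiguity_set Z c zhat rho in
  let vprimal := primal_value X P ell in
  let vdual := dual_value X P ell in
  [/\ vprimal \is a fin_num, vdual \is a fin_num, vprimal = vdual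
    & exists (xs : 'rV[R]_n) (Qs : probability (borel_rV R m) R),
        [/\ saddle_point X P ell xs Qs,
            is_minimum [set ereal_sup [set risk ell Q x | Q in P] | x in X]
              vprimal,
            is_maximum [set risk ell Q xs | Q in P] vprimal,
            is_maximum [set ereal_inf [set risk ell Q x | x in X] | Q in P]
              vdual
          & is_minimum [set risk ell Qs x | x in X] vdual]].
Proof.
have [x0 [Q0 [PQ0 Xx0 infc]]] : exists x0 Q0, [/\ ambiguity_set Z c zhat rho Q0,
    X x0 & inf_compact X (risk ell Q0)].
  by case: hQ0 => Q0 [x0 [PQ0 Xx0 infc _]]; exists x0, Q0.
have [nrm [p [hnrm p1 c_nrm growth1]]] := hgrowth.
have [c0 clsc c_diag c_convex] := hc.
have K0 : (0 < K)%N by exact: leq_trans hK.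
have ellk_growth (i : 'I_N) k x : X x -> forall e : R, 0 < e ->
    exists M, forall z, Z z -> ellk k x z <= M + e * c z (zhat i).
  move=> Xx e e0; have [p_eq1|p_neq1] := eqVneq p 1.
    have [g [z0 [r [g0 _ r01 gb]]]] := growth1 p_eq1 x Xx.
    apply: (sublinear_growth hnrm c_nrm p_eq1 (hzhat i) g0 r01 e0 (z0 := z0)).
    move=> z Zz; apply: le_trans (gb z Zz).
    by have [_] := hell x z; apply; exists k.
  by apply: (concave_growth hnrm c_nrm) => //; rewrite lt_def p_neq1.
have [xs [Qs [v [sad rv]]]] := dro_saddle_point hN K0 hrho hXconv hZclosed
  hZconv hzhat c0 c_diag (fun i => c_convex _ (hzhat i))
  (fun i => lsc_slice clsc (hzhat i))
  (fun i => cost_coercive hnrm p1 c_nrm (hzhat i)) hconvex hconcave hell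
  ellk_growth PQ0 Xx0 infc.
have [pv dv minP maxQ [maxD minx]] := saddle_point_values sad rv.
rewrite /= pv dv; split => //.
by exists xs, Qs.
Qed.
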